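(* Let $\mathcal H$ be a Hilbert space, $\mathcal D\subset\mathcal H$ dense, $\{H_i\}_{i=1}^n$ symmetric operators densely defined on $\mathcal D$, $I\subset\mathbb R$ an interval, and $f_i:I\to\mathbb R$, $1\le i\le n$. Define $H(t)=\sum_{i=1}^n f_i(t)H_i$ with $\operatorname{dom}H(t)=\mathcal D$. Assume (i) $H(t)$ is self-adjoint for all $t\in I$; (ii) $f_i\in C^1(I)$ for every $i$; (iii) for every $i$ there exists $K>0$, independent of $t$, such that $\|H_i\Psi\|\le K(\|H(t)\Psi\|+\|\Psi\|)$ for all $\Psi\in\mathcal D$ and all $t\in I$. Then there exists a strongly differentiable unitary propagator $U(t,s)$, $s,t\in I$, such that for every $\Psi_s\in\mathcal D$, $\Psi(t)=U(t,s)\Psi_s$ satisfies \[\frac{d}{dt}\Psi(t)=-iH(t)\Psi(t),\qquad \Psi(s)=\Psi_s.\]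
   Context: A unitary propagator is a two-parameter family of unitary operators $U(s,t)$, $s,t\in\mathbb R$ (here in $I$), such that $U(r,s)U(s,t)=U(r,t)$, $U(t,t)=I$, and $U(s,t)$ is jointly strongly continuous in $s$ and $t$. *)

(* Defs.v *)
From Stdlib Require Import Reals.
Open Scope R_scope.

Record C := mkC { Cre : R; Cim : R }.
Definition RtoC (x : R) : C := mkC x 0.
Definition C0 : C := RtoC 0.
Definition C1 : C := RtoC 1.
Definition Ci : C := mkC 0 1.
Definition Cadd (a b : C) : C := mkC (Cre a + Cre b) (Cim a + Cim b).
Definition Copp (a : C) : C := mkC (- Cre a) (- Cim a).
Definition Cmul (a b : C) : C :=
  mkC (Cre a * Cre b - Cim a * Cim b) (Cre a * Cim b + Cim a * Cre b).
Definition Cconj (a : C) : C := mkC (Cre a) (- Cim a).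

(* ---------- Complex Hilbert spaces ----------
   Inner product: conjugate-linear in the first argument, linear in the second. *)
Record HilbertSpace (V : Type) := {
  vzero : V;
  vadd : V -> V -> V;
  vopp : V -> V;
  vscal : C -> V -> V;
  inner : V -> V -> C;
  vadd_assoc : forall x y z, vadd x (vadd y z) = vadd (vadd x y) z;
  vadd_comm : forall x y, vadd x y = vadd y x;
  vadd_0 : forall x, vadd x vzero = x;
  vadd_opp : forall x, vadd x (vopp x) = vzero;
  vscal_1 : forall x, vscal C1 x = x;
  vscal_assoc : forall a b x, vscal a (vscal b x) = vscal (Cmul a b) x;
  vscal_distr_v : forall a x y, vscal a (vadd x y) = vadd (vscal a x) (vscal a y);
  vscal_distr_c : forall a b x, vscal (Cadd a b) x = vadd (vscal a x) (vscal b x);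
  inner_conj : forall x y, inner x y = Cconj (inner y x);
  inner_add_r : forall x y z, inner x (vadd y z) = Cadd (inner x y) (inner x z);
  inner_scal_r : forall a x y, inner x (vscal a y) = Cmul a (inner x y);
  inner_pos : forall x, 0 <= Cre (inner x x);
  inner_def : forall x, inner x x = C0 -> x = vzero;
  complete : forall u : nat -> V,
    (forall eps, eps > 0 -> exists N, forall m n, (m >= N)%nat -> (n >= N)%nat ->
        sqrt (Cre (inner (vadd (u m) (vopp (u n))) (vadd (u m) (vopp (u n))))) < eps) ->
    exists l, forall eps, eps > 0 -> exists N, forall n, (n >= N)%nat ->
        sqrt (Cre (inner (vadd (u n) (vopp l)) (vadd (u n) (vopp l)))) < eps
}.

Arguments vzero {V} h.
Arguments vadd {V} h.
Arguments vopp {V} h.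
Arguments vscal {V} h.
Arguments inner {V} h.

Section HS.
Context {V : Type} (HS : HilbertSpace V).

Definition vsub (x y : V) : V := vadd HS x (vopp HS y).
Definition vnorm (x : V) : R := sqrt (Cre (inner HS x x)).

Fixpoint vsum (n : nat) (g : nat -> V) : V :=
  match n with
  | O => vzero HS
  | S m => vadd HS (vsum m g) (g m)
  end.

Definition subspace (D : V -> Prop) : Prop :=
  D (vzero HS) /\
  (forall a x y, D x -> D y -> D (vadd HS (vscal HS a x) y)).

Definition dense (D : V -> Prop) : Prop :=
  forall x eps, eps > 0 -> exists y, D y /\ vnorm (vsub x y) < eps.

(* An operator with domain D is represented by a function V -> V whose values
   outside D are irrelevant. *)
Definition linear_on (D : V -> Prop) (A : V -> V) : Prop :=
  forall a x y, D x -> D y ->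
    A (vadd HS (vscal HS a x) y) = vadd HS (vscal HS a (A x)) (A y).

Definition symmetric_on (D : V -> Prop) (A : V -> V) : Prop :=
  linear_on D A /\
  forall x y, D x -> D y -> inner HS (A x) y = inner HS x (A y).

(* Self-adjointness of the densely defined operator (A, D): A is symmetric and
   dom A^* = D with A^* = A, i.e. whenever  <phi, A psi> = <eta, psi>  for all
   psi in D, then phi is in D and eta = A phi. *)
Definition self_adjoint_on (D : V -> Prop) (A : V -> V) : Prop :=
  symmetric_on D A /\
  forall phi eta,
    (forall psi, D psi -> inner HS phi (A psi) = inner HS eta psi) ->
    D phi /\ eta = A phi.

(* Derivative of a vector-valued function within the set I (one-sided at
   endpoints), in the norm topology. *)
Definition vderiv_within (I : R -> Prop) (g : R -> V) (t : R) (v : V) : Prop :=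
  forall eps, eps > 0 -> exists delta, delta > 0 /\
    forall h, h <> 0 -> Rabs h < delta -> I (t + h) ->
      vnorm (vsub (vscal HS (RtoC (/ h)) (vsub (g (t + h)) (g t))) v) < eps.

Definition unitary_propagator (I : R -> Prop) (U : R -> R -> V -> V) : Prop :=
  (forall t s, I t -> I s ->
     (forall a x y, U t s (vadd HS (vscal HS a x) y)
                    = vadd HS (vscal HS a (U t s x)) (U t s y)) /\
     (forall x y, inner HS (U t s x) (U t s y) = inner HS x y) /\
     (forall y, exists x, U t s x = y)) /\
  (forall r s t x, I r -> I s -> I t -> U r s (U s t x) = U r t x) /\
  (forall t x, I t -> U t t x = x) /\
  (forall x t s, I t -> I s -> forall eps, eps > 0 -> exists delta, delta > 0 /\
     forall t' s', I t' -> I s' -> Rabs (t' - t) < delta -> Rabs (s' - s) < delta ->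
       vnorm (vsub (U t' s' x) (U t s x)) < eps).

End HS.

Definition interval (I : R -> Prop) : Prop :=
  forall a b c, I a -> I c -> a <= b -> b <= c -> I b.

Definition deriv_within (I : R -> Prop) (f : R -> R) (t l : R) : Prop :=
  forall eps, eps > 0 -> exists delta, delta > 0 /\
    forall h, h <> 0 -> Rabs h < delta -> I (t + h) ->
      Rabs ((f (t + h) - f t) / h - l) < eps.

Definition continuous_within (I : R -> Prop) (g : R -> R) (t : R) : Prop :=
  forall eps, eps > 0 -> exists delta, delta > 0 /\
    forall t', I t' -> Rabs (t' - t) < delta -> Rabs (g t' - g t) < eps.

Definition C1_on (I : R -> Prop) (f : R -> R) : Prop :=
  exists f' : R -> R,
    (forall t, I t -> deriv_within I f t (f' t)) /\
    (forall t, I t -> continuous_within I f' t).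

(* Main.v *)
(* Put A(t) = -iH(t), which is skew-adjoint on D for the real inner product Re<.,.>.
   By (ii) and (iii), |(A(t) - A(s))x| <= L|t-s| (|A(s)x| + |x|) on compact subintervals.

   Existence: solve the backward Euler scheme u_{j+1} = u_j + h A(s+(j+1)h) u_{j+1} with
   h = (b-s)/2^m of either sign, which is possible since 1 - hA has range V. Applying
   A_{j+1} to the scheme gives |A_{j+1} u_{j+1}| <= |A_{j+1} u_j|, so that |A_j u_j| + |x0|
   grows by a factor of at most 1 + L|h| per step. In the energy identity for the difference
   of the schemes with steps h and h/2 skewness leaves only terms of order h^2, hence the
   difference is O(|h|^(1/2)) and the schemes converge. The limit x(t) is Lipschitz, stays
   in D because A(t)u stays bounded, and d/dt <psi, x(t)> = <psi, A(t)x(t)> for psi in D.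

   Uniqueness: such a weak solution has constant norm, because d/dt |x|^2 = 2<x, A(t)x> = 0.
   As the segment between s and t carries no orientation, this yields the cocycle identity
   for all orders of the three times.

   Strong derivative: at the initial time the difference quotients converge weakly to A(s)x0
   while their norms are bounded by a constant tending to |A(s)x0|, so they converge strongly;
   the cocycle identity moves this to every time. Density of D extends U to all of V. *)

From Stdlib Require Import Reals Lra Lia ClassicalEpsilon.
Require Import Defs.
Open Scope R_scope.

(** * Real functions on an interval: derivatives, mean values and Lipschitz bounds *)

Lemma Ceq (a b : C) : Cre a = Cre b -> Cim a = Cim b -> a = b.
Proof. destruct a, b; simpl; intros -> ->; reflexivity. Qed.

Lemma Rabs_le_inv x a : Rabs x <= a -> - a <= x <= a.
Proof. unfold Rabs. destruct Rcase_abs; lra. Qed.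

Lemma sq_Rabs x : x * x = Rabs x * Rabs x.
Proof. exact (Rsqr_abs x). Qed.

(** The retraction of the line onto [p, q]. Composing with it turns a function controlled only
    within [p, q] into one to which two-sided continuity applies, endpoints included. *)
Definition clamp (p q t : R) : R := Rmax p (Rmin t q).

Lemma clamp_id p q t : p <= t <= q -> clamp p q t = t.
Proof. intro H. unfold clamp. rewrite Rmin_left, Rmax_right; lra. Qed.

Lemma clamp_in p q t : p <= q -> p <= clamp p q t <= q.
Proof.
  intro H. unfold clamp. split; [apply Rmax_l |]. apply Rmax_lub; [exact H | apply Rmin_r].
Qed.

Lemma clamp_lip p q t t' : Rabs (clamp p q t' - clamp p q t) <= Rabs (t' - t).
Proof.
  unfold clamp, Rmax, Rmin, Rabs.
  repeat first [destruct Rle_dec | destruct Rcase_abs]; lra.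
Qed.

Lemma clamp_continuity p q g S c : p <= c <= q -> (forall t, p <= t <= q -> S t) ->
  continuous_within S g c -> continuity_pt (fun t => g (clamp p q t)) c.
Proof.
  intros Hc HS Hg eps Heps. destruct (Hg eps Heps) as [delta [Hd H]].
  exists delta. split; [exact Hd |]. intros t [_ Ht]. simpl in *. unfold Rdist in *.
  rewrite (clamp_id p q c Hc). apply H; [apply HS, clamp_in; lra |].
  eapply Rle_lt_trans; [| exact Ht]. rewrite <- (clamp_id p q c Hc) at 1. apply clamp_lip.
Qed.

Lemma deriv_within_continuous S g t l : deriv_within S g t l -> continuous_within S g t.
Proof.
  intros H eps Heps. destruct (H 1 Rlt_0_1) as [d [Hd Hg]].
  assert (Pl := Rabs_pos l).
  exists (Rmin d (eps / (Rabs l + 1))). split.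
  { apply Rmin_pos; [exact Hd | apply Rdiv_lt_0_compat; lra]. }
  intros t' St' Ht'.
  destruct (Req_dec t' t) as [-> | Hne]; [rewrite Rminus_diag, Rabs_R0; exact Heps |].
  specialize (Hg (t' - t) ltac:(lra) (Rlt_le_trans _ _ _ Ht' (Rmin_l _ _))).
  replace (t + (t' - t)) with t' in Hg by ring. specialize (Hg St').
  assert (E : g t' - g t = ((g t' - g t) / (t' - t) - l + l) * (t' - t)) by (field; lra).
  rewrite E, Rabs_mult.
  assert (B := Rabs_triang ((g t' - g t) / (t' - t) - l) l).
  assert (B2 := Rlt_le_trans _ _ _ Ht' (Rmin_r _ _)).
  apply Rle_lt_trans with ((Rabs l + 1) * Rabs (t' - t)).
  - apply Rmult_le_compat_r; [apply Rabs_pos | lra].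
  - apply (Rmult_lt_compat_l (Rabs l + 1)) in B2; [| lra].
    replace ((Rabs l + 1) * (eps / (Rabs l + 1))) with eps in B2 by (field; lra). exact B2.
Qed.

(** The classical mean value theorem is applied to [g] composed with [clamp]: the composite is
    continuous on all of [p, q] and coincides with [g] near each interior point, so the derivatives
    agree there. *)
Lemma mean_value_within S g M p q :
  p <= q -> (forall t, p <= t <= q -> S t) ->
  (forall t, p <= t <= q -> exists l, Rabs l <= M /\ deriv_within S g t l) ->
  Rabs (g q - g p) <= M * (q - p).
Proof.
  intros Hpq HS Hg. destruct (Req_dec p q) as [-> | Hne].
  { rewrite !Rminus_diag, Rabs_R0. lra. }
  set (G := fun t => g (clamp p q t)).
  assert (HG : forall t, p < t < q -> exists l, Rabs l <= M /\ derivable_pt_lim G t l).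
  { intros t Ht. destruct (Hg t ltac:(lra)) as [l [Hl Hd]]. exists l. split; [exact Hl |].
    intros eps Heps. destruct (Hd eps Heps) as [d [Hd0 Hd1]].
    assert (Hm : 0 < Rmin d (Rmin (t - p) (q - t))) by (repeat apply Rmin_pos; lra).
    exists (mkposreal _ Hm). intros k Hk0 Hk. simpl in Hk.
    assert (K1 := Rlt_le_trans _ _ _ Hk (Rmin_l _ _)).
    assert (K2 := Rlt_le_trans _ _ _ Hk (Rmin_r _ _)).
    assert (K3 := Rlt_le_trans _ _ _ K2 (Rmin_l _ _)).
    assert (K4 := Rlt_le_trans _ _ _ K2 (Rmin_r _ _)).
    apply Rabs_def2 in K3. apply Rabs_def2 in K4.
    unfold G. rewrite !clamp_id by lra. apply Hd1; [exact Hk0 | exact K1 |].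
    apply HS. lra. }
  (* [derivable_pt] carries the derivative as data, so it is extracted from the existential
     statement by description. *)
  assert (pr : forall c, p < c < q -> derivable_pt G c).
  { intros c Hc. destruct (constructive_indefinite_description _ (HG c Hc)) as [l [_ Hl]].
    exists l. exact Hl. }
  destruct (MVT G id p q pr (fun c _ => derivable_pt_id c)) as [c [Hc E]].
  - lra.
  - intros c Hc. apply (clamp_continuity p q g S c Hc HS).
    destruct (Hg c Hc) as [l [_ Hl]]. exact (deriv_within_continuous _ _ _ _ Hl).
  - intros c _. apply derivable_continuous_pt, derivable_pt_id.
  - destruct (HG c Hc) as [l [Hl Hd]].
    rewrite (derive_pt_eq_0 _ _ l (pr c Hc) Hd), derive_pt_id in E.
    unfold id, G in E. rewrite !clamp_id in E by lra.
    replace (g q - g p) with ((q - p) * l) by lra.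
    rewrite Rabs_mult, Rabs_right, Rmult_comm by lra. apply Rmult_le_compat_r; lra.
Qed.

(** The constant is the maximum of |f'| over the compact interval [p, q]. *)
Lemma C1_lipschitz I f p q : interval I -> C1_on I f -> I p -> I q -> p <= q ->
  exists M, 0 <= M /\
    forall t s, p <= t <= q -> p <= s <= q -> Rabs (f t - f s) <= M * Rabs (t - s).
Proof.
  intros HI [f' [Hd Hc]] Ip Iq Hpq.
  assert (HS : forall t, p <= t <= q -> I t) by (intros t Ht; apply (HI p t q); tauto).
  destruct (continuity_ab_maj (fun t => Rabs (f' (clamp p q t))) p q Hpq) as [m [Hm Hm']].
  { intros c Hcc.
    apply (continuity_pt_comp (fun t => f' (clamp p q t)) Rabs); [| apply Rcontinuity_abs].
    apply (clamp_continuity p q f' I c Hcc HS), Hc, HS, Hcc. }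
  exists (Rabs (f' (clamp p q m))). split; [apply Rabs_pos |].
  assert (B : forall t s, p <= s -> s <= t -> t <= q ->
            Rabs (f t - f s) <= Rabs (f' (clamp p q m)) * (t - s)).
  { intros t s H1 H2 H3. apply (mean_value_within I); [exact H2 | |].
    - intros r Hr. apply HS. lra.
    - intros r Hr. exists (f' r). split; [| apply Hd, HS; lra].
      assert (E := Hm r ltac:(lra)). cbv beta in E. rewrite clamp_id in E by lra. exact E. }
  intros t s Ht Hs. destruct (Rle_dec s t).
  - rewrite (Rabs_right (t - s)) by lra. apply B; lra.
  - rewrite (Rabs_minus_sym (f t)), (Rabs_left (t - s)) by lra.
    replace (- (t - s)) with (s - t) by ring. apply B; lra.
Qed.

(** Serves for the squared norm of a weak solution, whose increments turn out to be quadratic in the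
    time difference. *)
Lemma deriv_within_quadratic S g t K :
  (forall t', S t' -> Rabs (g t' - g t) <= K * ((t' - t) * (t' - t))) -> deriv_within S g t 0.
Proof.
  intros H eps Heps. assert (PK := Rabs_pos K). assert (KK := Rle_abs K).
  exists (eps / (Rabs K + 1)). split; [apply Rdiv_lt_0_compat; lra |].
  intros h Hh Hd HS. specialize (H _ HS). replace (t + h - t) with h in H by ring.
  assert (Ph : 0 < Rabs h) by (apply Rabs_pos_lt, Hh).
  rewrite Rminus_0_r. unfold Rdiv. rewrite Rabs_mult, Rabs_inv.
  apply (Rmult_lt_reg_r (Rabs h)); [exact Ph |].
  rewrite Rmult_assoc, Rinv_l, Rmult_1_r by lra.
  assert (E : h * h = Rabs h * Rabs h) by apply sq_Rabs.
  rewrite E in H. apply (Rmult_lt_compat_r (Rabs K + 1)) in Hd; [| lra].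
  replace (eps / (Rabs K + 1) * (Rabs K + 1)) with eps in Hd by (field; lra).
  eapply Rle_lt_trans; [exact H |].
  apply Rle_lt_trans with ((Rabs K + 1) * Rabs h * Rabs h).
  - rewrite Rmult_assoc. apply Rmult_le_compat_r; [apply Rmult_le_pos |]; lra.
  - apply Rmult_lt_compat_r; lra.
Qed.

(** * The real inner product space *)

Section RealStructure.
Context {V : Type} (HS : HilbertSpace V).

Local Notation "0v" := (vzero HS).
Local Notation "x [+] y" := (vadd HS x y) (at level 50, left associativity).
Local Notation "x [-] y" := (vsub HS x y) (at level 50, left associativity).
Local Notation nrm := (vnorm HS).

(** A real inner product inducing the same norm; the complex one is recovered from it through
    [inner_eq]. *)
Definition rip (x y : V) : R := Cre (inner HS x y).
Definition rscal (a : R) (x : V) : V := vscal HS (RtoC a) x.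
Local Notation "a [*] x" := (rscal a x) (at level 40, left associativity).

Lemma rip_sym x y : rip x y = rip y x.
Proof. unfold rip. rewrite inner_conj. reflexivity. Qed.

Lemma rip_add_r x y z : rip x (y [+] z) = rip x y + rip x z.
Proof. unfold rip. rewrite inner_add_r. reflexivity. Qed.

Lemma rip_add_l x y z : rip (y [+] z) x = rip y x + rip z x.
Proof. rewrite rip_sym, rip_add_r, (rip_sym x y), (rip_sym x z). reflexivity. Qed.

Lemma rip_0_r x : rip x 0v = 0.
Proof.
  assert (H := rip_add_r x 0v 0v). rewrite vadd_0 in H. lra.
Qed.

Lemma rip_0_l x : rip 0v x = 0.
Proof. rewrite rip_sym. apply rip_0_r. Qed.

Lemma rip_opp_r x y : rip x (vopp HS y) = - rip x y.
Proof.
  assert (H := rip_add_r x y (vopp HS y)). rewrite vadd_opp, rip_0_r in H. lra.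
Qed.

Lemma rip_opp_l x y : rip (vopp HS y) x = - rip y x.
Proof. rewrite rip_sym, rip_opp_r, rip_sym. reflexivity. Qed.

Lemma rip_rscal_r a x y : rip x (a [*] y) = a * rip x y.
Proof. unfold rip, rscal. rewrite inner_scal_r. simpl. ring. Qed.

Lemma rip_rscal_l a x y : rip (a [*] y) x = a * rip y x.
Proof. rewrite rip_sym, rip_rscal_r, rip_sym. reflexivity. Qed.

Lemma rip_Ci_r x y : rip x (vscal HS Ci y) = - Cim (inner HS x y).
Proof. unfold rip. rewrite inner_scal_r. simpl. ring. Qed.

Lemma rip_Ci_l x y : rip (vscal HS Ci x) y = - rip x (vscal HS Ci y).
Proof.
  rewrite rip_sym, !rip_Ci_r, (inner_conj _ HS y x). simpl. ring.
Qed.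

Lemma rip_vscal_r c x y :
  rip x (vscal HS c y) = Cre c * rip x y + Cim c * rip x (vscal HS Ci y).
Proof. rewrite rip_Ci_r. unfold rip. rewrite inner_scal_r. simpl. ring. Qed.

Lemma rip_vscal_l c x y :
  rip (vscal HS c x) y = Cre c * rip x y - Cim c * rip x (vscal HS Ci y).
Proof.
  rewrite rip_sym, rip_vscal_r, (rip_sym y x), (rip_sym y), rip_Ci_l. ring.
Qed.

(** The imaginary part of <x, y> is minus the real part of <x, i y>. *)
Lemma inner_eq x y x' y' :
  rip x y = rip x' y' -> rip x (vscal HS Ci y) = rip x' (vscal HS Ci y') ->
  inner HS x y = inner HS x' y'.
Proof. rewrite !rip_Ci_r. intros H1 H2. apply Ceq; [exact H1 | lra]. Qed.

Lemma rip_pos x : 0 <= rip x x.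
Proof. apply inner_pos. Qed.

Lemma rip_def x : rip x x = 0 -> x = 0v.
Proof.
  intro H. apply (inner_def _ HS), Ceq; [exact H |].
  assert (E := f_equal Cim (inner_conj _ HS x x)). simpl in *. lra.
Qed.

(** Testing against an arbitrary vector reduces vector identities to identities of real numbers; the
    tactic [vec] rests on this. *)
Lemma rip_ext x y : (forall z, rip z x = rip z y) -> x = y.
Proof.
  intro H.
  assert (E : x [+] vopp HS y = 0v).
  { apply rip_def. rewrite rip_add_r, rip_opp_r, H. ring. }
  rewrite <- (vadd_0 _ HS y), <- E, (vadd_comm _ HS x), vadd_assoc, vadd_opp.
  rewrite vadd_comm, vadd_0. reflexivity.
Qed.

Ltac rips := unfold vsub;
  repeat first
    [ rewrite rip_add_r | rewrite rip_add_l | rewrite rip_opp_r | rewrite rip_opp_l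
    | rewrite rip_rscal_r | rewrite rip_rscal_l | rewrite rip_0_r | rewrite rip_0_l ].
Ltac vec := apply rip_ext; intro; rips; try ring.

Lemma nrm_ge0 x : 0 <= nrm x.
Proof. apply sqrt_pos. Qed.

Lemma nrm_sq x : nrm x * nrm x = rip x x.
Proof. apply sqrt_sqrt, rip_pos. Qed.

Lemma nrm_le x c : 0 <= c -> rip x x <= c * c -> nrm x <= c.
Proof.
  intros Hc H. rewrite <- (sqrt_square c Hc). apply sqrt_le_1_alt, H.
Qed.

Lemma nrm_lt x c : 0 < c -> rip x x < c * c -> nrm x < c.
Proof.
  intros Hc H. rewrite <- (sqrt_square c) by lra. apply sqrt_lt_1_alt.
  split; [apply rip_pos | exact H].
Qed.

Lemma nrm_0 : nrm 0v = 0.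
Proof. unfold vnorm. fold (rip 0v 0v). rewrite rip_0_r. apply sqrt_0. Qed.

Lemma nrm_eq0 x : nrm x <= 0 -> x = 0v.
Proof.
  intro H. apply rip_def. rewrite <- nrm_sq. assert (P := nrm_ge0 x).
  replace (nrm x) with 0 by lra. ring.
Qed.

Lemma vsub_eq x y : x [-] y = 0v -> x = y.
Proof.
  intro H. apply rip_ext. intro z. assert (E := f_equal (rip z) H).
  revert E. rips. lra.
Qed.

Lemma nrm_sub_eq x y : nrm (x [-] y) <= 0 -> x = y.
Proof. intro H. apply vsub_eq, nrm_eq0, H. Qed.

Lemma nrm_rscal a x : nrm (a [*] x) = Rabs a * nrm x.
Proof.
  unfold vnorm. fold (rip (a [*] x) (a [*] x)) (rip x x). rips.
  rewrite <- Rmult_assoc, sqrt_mult_alt by apply Rle_0_sqr.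
  f_equal. apply sqrt_Rsqr_abs.
Qed.

Lemma cauchy_schwarz x y : Rabs (rip x y) <= nrm x * nrm y.
Proof.
  assert (P : forall x y, rip x y <= nrm x * nrm y).
  { clear. intros x y.
    assert (Hx := nrm_ge0 x). assert (Hy := nrm_ge0 y).
    destruct (Req_dec (nrm x) 0) as [E | E].
    { rewrite (nrm_eq0 x) by lra. rewrite rip_0_l, nrm_0. lra. }
    destruct (Req_dec (nrm y) 0) as [E' | E'].
    { rewrite (nrm_eq0 y) by lra. rewrite rip_0_r, nrm_0. lra. }
    (* Expanding the square of |y| x - |x| y gives 2 |x| |y| (|x| |y| - <x, y>) >= 0. *)
    assert (Q := rip_pos (nrm y [*] x [-] nrm x [*] y)). revert Q. rips.
    rewrite (rip_sym y x), <- !nrm_sq. intro Q.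
    assert (0 < nrm x * nrm y) by (apply Rmult_lt_0_compat; lra).
    apply (Rmult_le_reg_l (nrm x * nrm y)); nra. }
  apply Rabs_le. split; [| apply P].
  assert (H := P ((-1) [*] x) y). rewrite nrm_rscal, rip_rscal_l in H.
  rewrite Rabs_left in H by lra. lra.
Qed.

Lemma nrm_triangle x y : nrm (x [+] y) <= nrm x + nrm y.
Proof.
  assert (Hx := nrm_ge0 x). assert (Hy := nrm_ge0 y).
  apply nrm_le; [lra |]. rips. rewrite (rip_sym y x), <- !nrm_sq.
  assert (H := cauchy_schwarz x y). assert (H' := Rle_abs (rip x y)). lra.
Qed.

Lemma nrm_sub_sym x y : nrm (x [-] y) = nrm (y [-] x).
Proof.
  replace (x [-] y) with ((-1) [*] (y [-] x)) by vec.
  rewrite nrm_rscal, Rabs_left by lra. lra.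
Qed.

Lemma nrm_sub_triangle x y z : nrm (x [-] z) <= nrm (x [-] y) + nrm (y [-] z).
Proof. replace (x [-] z) with ((x [-] y) [+] (y [-] z)) by vec. apply nrm_triangle. Qed.

Lemma nrm_sub_le x y : nrm (x [-] y) <= nrm x + nrm y.
Proof.
  assert (H := nrm_sub_triangle x 0v y). rewrite (nrm_sub_sym 0v y) in H.
  replace (x [-] 0v) with x in H by vec. replace (y [-] 0v) with y in H by vec. exact H.
Qed.

Lemma nrm_le_sub x y : nrm x <= nrm y + nrm (x [-] y).
Proof. replace x with (y [+] (x [-] y)) at 1 by vec. apply nrm_triangle. Qed.

Lemma nrm_vscal_le c x : nrm (vscal HS c x) <= (Rabs (Cre c) + Rabs (Cim c)) * nrm x.
Proof.
  assert (Hi : nrm (vscal HS Ci x) = nrm x).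
  { unfold vnorm. f_equal. fold (rip (vscal HS Ci x) (vscal HS Ci x)) (rip x x).
    rewrite rip_Ci_l, rip_Ci_r, inner_scal_r. simpl. unfold rip. ring. }
  replace (vscal HS c x) with (Cre c [*] x [+] Cim c [*] vscal HS Ci x)
    by (apply rip_ext; intro; rips; rewrite (rip_vscal_r c); ring).
  eapply Rle_trans; [apply nrm_triangle |]. rewrite !nrm_rscal, Hi. lra.
Qed.

(** * Null sequences, norm limits and the representation of bounded functionals *)

Definition cv0 (e : nat -> R) : Prop :=
  forall eps, eps > 0 -> exists N, forall n, (n >= N)%nat -> Rabs (e n) < eps.

Definition vlim (u : nat -> V) (l : V) : Prop := cv0 (fun n => nrm (u n [-] l)).

Lemma cv0_plus e f : cv0 e -> cv0 f -> cv0 (fun n => e n + f n).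
Proof.
  intros He Hf eps Heps.
  destruct (He (eps / 2)) as [N HN]; [lra |]. destruct (Hf (eps / 2)) as [M HM]; [lra |].
  exists (N + M)%nat. intros n Hn. specialize (HN n ltac:(lia)). specialize (HM n ltac:(lia)).
  assert (H := Rabs_triang (e n) (f n)). lra.
Qed.

Lemma cv0_scal c e : cv0 e -> cv0 (fun n => c * e n).
Proof.
  intros He eps Heps. assert (Hc := Rabs_pos c).
  destruct (He (eps / (Rabs c + 1))) as [N HN].
  { apply Rdiv_lt_0_compat; lra. }
  exists N. intros n Hn. specialize (HN n Hn). rewrite Rabs_mult.
  assert (P := Rabs_pos (e n)).
  assert (Rabs (e n) * (Rabs c + 1) < eps / (Rabs c + 1) * (Rabs c + 1))
    by (apply Rmult_lt_compat_r; lra).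
  replace (eps / (Rabs c + 1) * (Rabs c + 1)) with eps in H by (field; lra). nra.
Qed.

Lemma cv0_le_ev a b e N : (forall n, (n >= N)%nat -> a <= b + e n) -> cv0 e -> a <= b.
Proof.
  intros H He. apply Rle_plus_epsilon. intros eps Heps.
  destruct (He eps Heps) as [M HM]. specialize (HM (N + M)%nat ltac:(lia)).
  specialize (H (N + M)%nat ltac:(lia)). assert (Q := Rle_abs (e (N + M)%nat)). lra.
Qed.

(** The usual form of a passage to the limit below: an inequality between fixed numbers holds up to
    a null sequence. *)
Lemma cv0_le a b e : (forall n, a <= b + e n) -> cv0 e -> a <= b.
Proof. intros H. apply (cv0_le_ev a b e 0). auto. Qed.

Lemma cv0_inv_nat : cv0 (fun n => / (INR n + 1)).
Proof.
  intros eps Heps. destruct (archimed_cor1 eps Heps) as [N [HN1 HN2]].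
  exists N. intros n Hn. assert (P : 0 < INR N) by (apply lt_0_INR; lia).
  assert (INR N <= INR n) by (apply le_INR; lia).
  rewrite Rabs_right by (apply Rle_ge, Rlt_le, Rinv_0_lt_compat; lra).
  apply Rle_lt_trans with (/ INR N); [| exact HN1]. apply Rinv_le_contravar; lra.
Qed.

Lemma cauchy_vlim u :
  (forall eps, eps > 0 -> exists N, forall m n, (m >= N)%nat -> (n >= N)%nat ->
     nrm (u m [-] u n) < eps) -> exists l, vlim u l.
Proof.
  intro H. destruct (complete _ HS u H) as [l Hl]. exists l. intros eps Heps.
  destruct (Hl eps Heps) as [N HN]. exists N. intros n Hn.
  rewrite Rabs_right by apply Rle_ge, nrm_ge0. apply HN, Hn.
Qed.

Lemma vlim_rip u l y : vlim u l -> cv0 (fun n => rip (u n) y - rip l y).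
Proof.
  intros H eps Heps.
  destruct (cv0_scal (nrm y) _ H eps Heps) as [N HN]. exists N. intros n Hn.
  eapply Rle_lt_trans; [| apply (HN n Hn)].
  replace (rip (u n) y - rip l y) with (rip (u n [-] l) y) by (rips; ring).
  rewrite (Rabs_right (nrm y * _)).
  - rewrite Rmult_comm. apply cauchy_schwarz.
  - apply Rle_ge, Rmult_le_pos; apply nrm_ge0.
Qed.

Lemma cv0_opp e : cv0 e -> cv0 (fun n => - e n).
Proof.
  intros H eps Heps. destruct (H eps Heps) as [N HN]. exists N. intros n Hn.
  rewrite Rabs_Ropp. auto.
Qed.

(* The representing vector lies in the closure of W: it is the limit of a
   minimizing sequence of |w|^2 - 2 l(w). *)
Lemma riesz (W : V -> Prop) (l : V -> R) (c : R) :
  W 0v -> (forall a x y, W x -> W y -> W (a [*] x [+] y)) ->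
  (forall a x y, W x -> W y -> l (a [*] x [+] y) = a * l x + l y) ->
  (forall w, W w -> Rabs (l w) <= c * nrm w) ->
  exists eta w, (forall n, W (w n)) /\ vlim w eta /\ forall x, W x -> rip eta x = l x.
Proof.
  intros W0 Wlin Hl Hc.
  assert (l0 : l 0v = 0).
  { assert (E := Hl 1 0v 0v W0 W0). replace (1 [*] 0v [+] 0v) with 0v in E by vec. lra. }
  set (F := fun w => 2 * l w - rip w w).
  destruct (completeness (fun r => exists w, W w /\ r = F w)) as [m [Hub Hlub]].
  (* [F] is bounded above by completing the square: 2 c |w| - |w|^2 <= c^2. *)
  { exists (c * c). intros r [w [Hw ->]]. unfold F.
    assert (H1 := Hc w Hw). assert (H2 := Rle_abs (l w)). rewrite <- nrm_sq.
    assert (0 <= (c - nrm w) * (c - nrm w)) by apply Rle_0_sqr. nra. }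
  { exists (F 0v), 0v. split; [exact W0 | reflexivity]. }
  assert (Fm : forall w, W w -> F w <= m) by (intros w Hw; apply Hub; exists w; auto).
  assert (Hn : forall n : nat, exists w, W w /\ m - / (INR n + 1) < F w).
  { intro n. apply NNPP. intro Hno.
    assert (P : 0 < / (INR n + 1)) by (apply Rinv_0_lt_compat; assert (Q := pos_INR n); lra).
    assert (m <= m - / (INR n + 1)); [| lra].
    apply Hlub. intros r [w [Hw ->]]. apply Rnot_lt_le. intro Hlt. apply Hno. eauto. }
  pose (w := fun n => proj1_sig (constructive_indefinite_description _ (Hn n))).
  assert (Hw : forall n, W (w n) /\ m - / (INR n + 1) < F (w n)).
  { intro n. exact (proj2_sig (constructive_indefinite_description _ (Hn n))). }
  clearbody w.
  destruct (cauchy_vlim w) as [eta Heta].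
  { intros eps Heps. assert (Hq : eps * eps / 4 > 0) by nra.
    destruct (cv0_inv_nat _ Hq) as [N HN]. exists N. intros i j Hi Hj.
    destruct (Hw i) as [Wi Fi]. destruct (Hw j) as [Wj Fj].
    assert (Ai := HN i Hi). assert (Aj := HN j Hj).
    assert (Bi := Rle_abs (/ (INR i + 1))). assert (Bj := Rle_abs (/ (INR j + 1))).
    (* Midpoint argument: |w_i - w_j|^2 = 4 F((w_i + w_j)/2) - 2 F(w_i) - 2 F(w_j), which is at most
       2/(i+1) + 2/(j+1) because [F] never exceeds [m]. *)
    assert (Wz : W (/2 [*] w j [+] 0v)) by (apply Wlin; auto).
    assert (Fij := Fm _ (Wlin (/2) _ _ Wi Wz)). unfold F in *.
    rewrite !Hl, l0 in Fij by auto.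
    revert Fij. rips. rewrite (rip_sym (w j) (w i)). intro Fij.
    assert (E : rip (w i [-] w j) (w i [-] w j) < eps * eps).
    { rips. rewrite (rip_sym (w j) (w i)). lra. }
    apply nrm_lt; [lra | exact E]. }
  exists eta, w. split; [apply Hw |]. split; [exact Heta |].
  intros x Wx.
  (* First variation: perturbing [w n] by [a] times [x] cannot raise [F] above [m], so in the limit
     the term linear in [a] is dominated by the quadratic one. *)
  assert (Q : forall a, 2 * a * (l x - rip eta x) <= a * a * rip x x).
  { intro a.
    apply (cv0_le _ _ (fun n => / (INR n + 1) + 2 * a * (rip (w n) x - rip eta x))).
    - intro n. destruct (Hw n) as [Wn Fn]. assert (Fa := Fm _ (Wlin a x (w n) Wx Wn)).
      unfold F in *. rewrite Hl in Fa by auto. revert Fa. rips.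
      rewrite (rip_sym x (w n)). intro Fa. lra.
    - apply cv0_plus; [apply cv0_inv_nat |]. apply cv0_scal, vlim_rip, Heta. }
  assert (P := rip_pos x). set (d := l x - rip eta x) in *. set (q := rip x x) in *.
  (* The denominator [q + 1] allows [q] = |x|^2 to vanish; this value of [a] already forces
     [d = 0]. *)
  assert (Qd := Q (d / (q + 1))).
  assert (E : 2 * (d / (q + 1)) * d - d / (q + 1) * (d / (q + 1)) * q
              = (d / (q + 1)) * (d / (q + 1)) * (q + 2)) by (field; lra).
  assert (Z : 0 <= (d / (q + 1)) * (d / (q + 1))) by apply Rle_0_sqr.
  assert (Z0 : (d / (q + 1)) * (d / (q + 1)) = 0) by nra.
  assert (Z1 : d / (q + 1) = 0) by nra.
  assert (d = d / (q + 1) * (q + 1)) by (field; lra).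
  rewrite Z1 in H. unfold d in H. lra.
Qed.

(** * Skew-adjoint operators *)

Context (D : V -> Prop) (HD : subspace HS D).

(** The last two clauses say that the adjoint of [A] for [rip] is -A with domain exactly [D].
    Linearity is complex so that the propagator inherits it. *)
Definition skew_adjoint (A : V -> V) : Prop :=
  (forall c x y, D x -> D y ->
     A (vscal HS c x [+] y) = vscal HS c (A x) [+] A y) /\
  (forall x y, D x -> D y -> rip x (A y) = - rip (A x) y) /\
  (forall phi eta, (forall psi, D psi -> rip phi (A psi) = - rip eta psi) ->
     D phi /\ eta = A phi).

Lemma D_0 : D 0v.
Proof. apply HD. Qed.

Lemma D_lin c x y : D x -> D y -> D (vscal HS c x [+] y).
Proof. apply HD. Qed.

(** Closure of [D] and linearity are given for combinations c x + y; this identity and [vsub_eq_lin]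
    bring multiples and differences to that shape. *)
Lemma vscal_eq_add c x : vscal HS c x = vscal HS c x [+] 0v.
Proof. vec. Qed.

Lemma D_vscal c x : D x -> D (vscal HS c x).
Proof. intro H. rewrite vscal_eq_add. apply D_lin; [exact H | apply D_0]. Qed.

Lemma vsub_eq_lin x y : x [-] y = (-1) [*] y [+] x.
Proof. vec. Qed.

Lemma D_sub x y : D x -> D y -> D (x [-] y).
Proof. intros Hx Hy. rewrite vsub_eq_lin. apply D_lin; assumption. Qed.

Section SkewAdjoint.
Context (A : V -> V) (HA : skew_adjoint A).

Lemma A_rlin a x y : D x -> D y -> A (a [*] x [+] y) = a [*] A x [+] A y.
Proof. apply HA. Qed.

Lemma A_0 : A 0v = 0v.
Proof.
  assert (E := A_rlin (-1) 0v 0v D_0 D_0).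
  replace ((-1) [*] 0v [+] 0v) with 0v in E by vec.
  rewrite E. vec.
Qed.

Lemma A_vscal c x : D x -> A (vscal HS c x) = vscal HS c (A x).
Proof.
  intro H. rewrite vscal_eq_add. rewrite (proj1 HA) by (assumption || apply D_0).
  rewrite A_0. vec.
Qed.

Lemma A_rscal a x : D x -> A (a [*] x) = a [*] A x.
Proof. apply A_vscal. Qed.

Lemma A_sub x y : D x -> D y -> A (x [-] y) = A x [-] A y.
Proof. intros Hx Hy. rewrite !vsub_eq_lin. apply A_rlin; assumption. Qed.

Lemma A_skew x y : D x -> D y -> rip x (A y) = - rip (A x) y.
Proof. apply HA. Qed.

Lemma rip_A_self x : D x -> rip x (A x) = 0.
Proof. intro H. assert (E := A_skew x x H H). rewrite (rip_sym (A x)) in E. lra. Qed.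

(** As [x] and [A x] are orthogonal, |x - h A x|^2 = |x|^2 + h^2 |A x|^2. The sign of [h] does not
    matter, so the scheme is stable in both time directions. *)
Lemma nrm_resolvent_le h x : D x -> nrm x <= nrm (x [-] h [*] A x).
Proof.
  intro Hx. apply nrm_le; [apply nrm_ge0 |]. rewrite nrm_sq. rips.
  rewrite (rip_sym (A x) x), rip_A_self by exact Hx.
  assert (P := Rmult_le_pos _ _ (Rle_0_sqr h) (rip_pos (A x))). unfold Rsqr in P. lra.
Qed.

(** For nonzero [h], [A x] is a multiple of the difference of two elements of [D]; it lies in [D]
    and the previous estimate applies to it. *)
Lemma nrm_A_resolvent_le h x :
  D x -> D (x [-] h [*] A x) -> nrm (A x) <= nrm (A (x [-] h [*] A x)).
Proof.
  intros Hx Hw. destruct (Req_dec h 0) as [-> | Hh].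
  { replace (x [-] 0 [*] A x) with x by vec. lra. }
  assert (HAx : D (A x)).
  { replace (A x) with ((/ h) [*] (x [-] (x [-] h [*] A x))) by (vec; field; exact Hh).
    apply D_vscal, D_sub; assumption. }
  rewrite A_sub, A_rscal by (try apply D_vscal; assumption).
  apply nrm_resolvent_le, HAx.
Qed.

(** The range of 1 - hA is closed with trivial orthogonal complement. [riesz] supplies the
    projection [eta] of [y] onto the closure of the range. *)
Lemma resolvent_exists h y : D y -> exists x, D x /\ y = x [-] h [*] A x.
Proof.
  intro Hy. destruct (Req_dec h 0) as [-> | Hh].
  { exists y. split; [exact Hy | vec]. }
  destruct (riesz (fun w => exists x, D x /\ w = x [-] h [*] A x) (rip y) (nrm y))
    as (eta & w & Hw & Hlim & Heta).
  - exists 0v. split; [apply D_0 |]. rewrite A_0. vec.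
  - intros a w w' [x [Hx ->]] [x' [Hx' ->]]. exists (a [*] x [+] x').
    split; [apply D_lin; assumption |]. rewrite A_rlin by assumption. vec.
  - intros. rips. ring.
  - intros. apply cauchy_schwarz.
  - pose (x := fun n => proj1_sig (constructive_indefinite_description _ (Hw n))).
    assert (Hx : forall n, D (x n) /\ w n = x n [-] h [*] A (x n)).
    { intro n. exact (proj2_sig (constructive_indefinite_description _ (Hw n))). }
    clearbody x.
    (* Since 1 - hA does not shrink norms, preimages of a Cauchy sequence form a Cauchy sequence. *)
    destruct (cauchy_vlim x) as [l Hl].
    { intros eps Heps. destruct (Hlim (eps / 2)) as [N HN]; [lra |].
      exists N. intros i j Hi Hj. specialize (HN i Hi) as Ai. specialize (HN j Hj) as Aj.
      rewrite Rabs_right in Ai, Aj by apply Rle_ge, nrm_ge0.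
      destruct (Hx i) as [Dxi Ei]. destruct (Hx j) as [Dxj Ej].
      assert (B := nrm_resolvent_le h _ (D_sub _ _ Dxi Dxj)).
      rewrite A_sub in B by assumption.
      replace (x i [-] x j [-] h [*] (A (x i) [-] A (x j))) with (w i [-] w j) in B
        by (rewrite Ei, Ej; vec).
      assert (T := nrm_sub_triangle (w i) eta (w j)).
      rewrite (nrm_sub_sym eta) in T. lra. }
    (* Skewness gives <x_n, A psi> = -<(x_n - w_n)/h, psi>; in the limit, maximality of [A] puts [l]
       in [D] with A l = (l - eta)/h. *)
    destruct (proj2 (proj2 HA) l ((/ h) [*] (l [-] eta))) as [Dl El].
    { intros psi Hpsi.
      assert (E : rip l (A psi) + rip ((/ h) [*] (l [-] eta)) psi = 0).
      { assert (L1 := vlim_rip _ _ (A psi) Hl). assert (L2 := vlim_rip _ _ psi Hl).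
        assert (L3 := vlim_rip _ _ psi Hlim).
        assert (L := cv0_plus _ _ L1 (cv0_plus _ _ (cv0_scal (/ h) _ L2)
                                              (cv0_scal (- / h) _ L3))).
        assert (Ez : forall n, rip (x n) (A psi) + / h * rip (x n) psi
                               - / h * rip (w n) psi = 0).
        { intro n. destruct (Hx n) as [Dn En]. rewrite En. rips.
          rewrite A_skew by assumption. field. exact Hh. }
        rips.
        apply Rle_antisym.
        - apply (fun H => cv0_le _ _ _ H (cv0_opp _ L)). intro n. specialize (Ez n). cbv beta. lra.
        - apply (fun H => cv0_le _ _ _ H L). intro n. specialize (Ez n). cbv beta. lra. }
      lra. }
    assert (Eeta : eta = l [-] h [*] A l) by (rewrite <- El; vec; field; exact Hh).
    exists l. split; [exact Dl |]. rewrite <- Eeta. apply vsub_eq.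
    (* The residue z = y - eta is orthogonal to the range, so maximality yields z in [D] with h A z
       = -z. Then z - h A z = 2 z is orthogonal to z, and z vanishes. *)
    assert (Hz : forall x, D x -> rip (y [-] eta) (x [-] h [*] A x) = 0).
    { intros x' Hx'. specialize (Heta (x' [-] h [*] A x')).
      assert (Q : rip eta (x' [-] h [*] A x') = rip y (x' [-] h [*] A x'))
        by (apply Heta; eauto).
      revert Q. generalize (x' [-] h [*] A x'). intros v Q. rips. lra. }
    destruct (proj2 (proj2 HA) (y [-] eta) ((- / h) [*] (y [-] eta))) as [Dz Ez].
    { intros psi Hpsi. specialize (Hz psi Hpsi). revert Hz.
      generalize (y [-] eta). intros z Hz. revert Hz. rips. intro Hz.
      apply (Rmult_eq_reg_l h); [| exact Hh]. field_simplify; [lra | exact Hh]. }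
    specialize (Hz _ Dz). rewrite <- Ez in Hz.
    apply rip_def. revert Hz. generalize (y [-] eta). intros z. rips. intro Hz.
    replace (rip z z - h * (- / h * rip z z)) with (2 * rip z z) in Hz by (field; exact Hh).
    assert (rip z z + - (h * (- / h * rip z z)) = 2 * rip z z) by (field; exact Hh). lra.
Qed.

(** On [D] the functional psi -> <l, A psi> is a limit of functionals bounded by [C]. [riesz]
    represents it by a vector, and maximality then places [l] in the domain. *)
Lemma D_closed x C l : (forall n, D (x n)) -> (forall n, nrm (A (x n)) <= C) -> vlim x l -> D l.
Proof.
  intros Dx HC Hl.
  destruct (riesz D (fun psi => rip l (A psi)) C) as (eta & _ & _ & _ & Heta).
  - apply D_0.
  - intros. apply D_lin; assumption.
  - intros. rewrite A_rlin by assumption. rips. ring.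
  - intros psi Hpsi.
    assert (B : forall n, Rabs (rip (x n) (A psi)) <= C * nrm psi).
    { intro n. rewrite A_skew, Rabs_Ropp by auto.
      eapply Rle_trans; [apply cauchy_schwarz |].
      apply Rmult_le_compat_r; [apply nrm_ge0 | apply HC]. }
    assert (L := vlim_rip _ _ (A psi) Hl).
    apply Rabs_le. split.
    + assert (- rip l (A psi) <= C * nrm psi); [| lra].
      apply (fun H => cv0_le _ _ _ H L). intro n.
      specialize (B n). apply Rabs_le_inv in B. lra.
    + apply (fun H => cv0_le _ _ _ H (cv0_opp _ L)). intro n.
      specialize (B n). apply Rabs_le_inv in B. lra.
  - apply (proj2 (proj2 HA) l ((-1) [*] eta)). intros psi Hpsi.
    rewrite <- Heta by exact Hpsi. rips. ring.
Qed.

End SkewAdjoint.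

(** * The backward Euler scheme *)

Section Evolution.
Context (A : R -> V -> V) (J : R -> Prop) (L : R) (HL : 0 <= L)
  (HA : forall t, J t -> skew_adjoint (A t))
  (Hlip : forall t s x, J t -> J s -> D x ->
     nrm (A t x [-] A s x) <= L * Rabs (t - s) * (nrm (A s x) + nrm x)).

(** Choice makes the step a total function; the defining equation is available once [J t] and [D y]
    hold. *)
Definition euler_step (t h : R) (y : V) : V :=
  epsilon (inhabits 0v) (fun x => D x /\ y = x [-] h [*] A t x).

Fixpoint euler (s h : R) (x0 : V) (j : nat) : V :=
  match j with
  | O => x0
  | S i => euler_step (s + INR (S i) * h) h (euler s h x0 i)
  end.

Section Grid.
Context (s h : R) (N : nat) (x0 : V) (Dx0 : D x0)
  (HJ : forall j, (j <= N)%nat -> J (s + INR j * h)).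
Local Notation u := (euler s h x0).
Local Notation tm j := (s + INR j * h).

Lemma euler_D j : (j <= N)%nat -> D (u j).
Proof.
  induction j as [| j IH]; intro Hj; [exact Dx0 |].
  destruct (epsilon_spec (inhabits 0v) (fun x => D x /\ u j = x [-] h [*] A (tm (S j)) x))
    as [HD' _]; [| exact HD'].
  apply resolvent_exists; [apply HA, HJ, Hj | apply IH; lia].
Qed.

Lemma euler_eq j : (S j <= N)%nat -> u j = u (S j) [-] h [*] A (tm (S j)) (u (S j)).
Proof.
  intro Hj.
  apply (epsilon_spec (inhabits 0v) (fun x => D x /\ u j = x [-] h [*] A (tm (S j)) x)).
  apply resolvent_exists; [apply HA, HJ, Hj | apply euler_D; lia].
Qed.

Lemma euler_nrm j : (j <= N)%nat -> nrm (u j) <= nrm x0.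
Proof.
  induction j as [| j IH]; intro Hj; [apply Rle_refl |].
  eapply Rle_trans; [| apply IH; lia]. rewrite (euler_eq j Hj).
  apply nrm_resolvent_le; [apply HA, HJ, Hj | apply euler_D, Hj].
Qed.

(** Adding |x0|, which dominates every |u_j|, makes the recursion purely multiplicative, with factor
    1 + L|h| <= exp(L|h|). *)
Lemma euler_A_bound j : (j <= N)%nat ->
  nrm (A (tm j) (u j)) + nrm x0 <= exp (L * (Rabs h * INR j)) * (nrm (A s x0) + nrm x0).
Proof.
  induction j as [| j IH]; intro Hj.
  { simpl. rewrite !Rmult_0_l, Rplus_0_r, !Rmult_0_r, exp_0. lra. }
  specialize (IH ltac:(lia)).
  assert (Dj : D (u j)) by (apply euler_D; lia).
  assert (B1 : nrm (A (tm (S j)) (u (S j))) <= nrm (A (tm (S j)) (u j))).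
  { assert (E := euler_eq j Hj). rewrite E in Dj. rewrite E.
    apply nrm_A_resolvent_le; [apply HA, HJ, Hj | apply euler_D, Hj | exact Dj]. }
  assert (B2 := Hlip (tm (S j)) (tm j) (u j) (HJ _ Hj) (HJ j ltac:(lia)) Dj).
  replace (tm (S j) - tm j) with h in B2 by (rewrite S_INR; ring).
  assert (B3 := nrm_le_sub (A (tm (S j)) (u j)) (A (tm j) (u j))).
  assert (B4 := euler_nrm j ltac:(lia)).
  replace (L * (Rabs h * INR (S j))) with (L * Rabs h + L * (Rabs h * INR j))
    by (rewrite S_INR; ring).
  rewrite exp_plus, Rmult_assoc.
  assert (P := Rmult_le_pos _ _ HL (Rabs_pos h)).
  assert (E1 := exp_ineq1_le (L * Rabs h)).
  assert (P0 := nrm_ge0 x0). assert (P1 := nrm_ge0 (A (tm j) (u j))).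
  apply Rle_trans with ((1 + L * Rabs h) * (nrm (A (tm j) (u j)) + nrm x0)).
  - assert (L * Rabs h * nrm (u j) <= L * Rabs h * nrm x0)
      by (apply Rmult_le_compat_l; assumption). lra.
  - apply Rmult_le_compat; lra.
Qed.

Context (C : R) (HC : forall j, (j <= N)%nat -> nrm (A (tm j) (u j)) <= C).

Lemma euler_lip i k : (i + k <= N)%nat ->
  nrm (u (i + k)%nat [-] u i) <= C * (Rabs h * INR k).
Proof.
  induction k as [| k IH]; intro Hk.
  { rewrite Nat.add_0_r. simpl. replace (u i [-] u i) with 0v by vec. rewrite nrm_0. lra. }
  rewrite Nat.add_succ_r in *. specialize (IH ltac:(lia)).
  eapply Rle_trans; [apply (nrm_sub_triangle _ (u (i + k)%nat)) |].
  rewrite (euler_eq (i + k) Hk) at 1.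
  set (w := u (S (i + k))) in *.
  replace (w [-] (w [-] h [*] A (tm (S (i + k))) w))
    with (h [*] A (tm (S (i + k))) w) by vec.
  rewrite nrm_rscal, (S_INR k).
  assert (Rabs h * nrm (A (tm (S (i + k))) w) <= Rabs h * C)
    by (apply Rmult_le_compat_l; [apply Rabs_pos | apply HC, Hk]).
  lra.
Qed.

(** The steps are summed after moving [A] onto the fixed vector [psi], which is why [c], a reference
    value of <A psi, u>, enters with a plus sign. *)
Lemma euler_weak psi i k c M : D psi -> (i + k <= N)%nat ->
  (forall l, (i < l <= i + k)%nat -> Rabs (rip (A (tm l) psi) (u l) - c) <= M) ->
  Rabs (rip psi (u (i + k)%nat [-] u i) + INR k * h * c) <= INR k * Rabs h * M.
Proof.
  intros Dpsi. induction k as [| k IH]; intros Hk HM.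
  { rewrite Nat.add_0_r. simpl. rips.
    replace (rip psi (u i) + - rip psi (u i) + 0 * h * c) with 0 by ring.
    rewrite Rabs_R0. lra. }
  rewrite Nat.add_succ_r in *. specialize (IH ltac:(lia) ltac:(intros; apply HM; lia)).
  specialize (HM (S (i + k)) ltac:(lia)).
  replace (rip psi (u (S (i + k)) [-] u i) + INR (S k) * h * c)
    with ((rip psi (u (i + k)%nat [-] u i) + INR k * h * c)
          + (- h) * (rip (A (tm (S (i + k))) psi) (u (S (i + k))) - c)).
  - eapply Rle_trans; [apply Rabs_triang |]. rewrite Rabs_mult, Rabs_Ropp.
    assert (P := Rmult_le_compat_l _ _ _ (Rabs_pos h) HM). rewrite (S_INR k). lra.
  - rewrite (euler_eq (i + k) Hk), (S_INR k). rips.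
    rewrite (A_skew (A (tm (S (i + k)))) (HA _ (HJ _ Hk)) psi)
      by (try apply euler_D; assumption).
    ring.
Qed.

End Grid.

(* One step of size h/2 of the error e between a piecewise linear interpolant of slope
   A t1 x1 and the scheme on the grid refined by two; [a] measures the distance from the
   interpolant to x1. Skewness kills the term linear in the step. *)
Lemma energy_step h t1 t2 x1 z a e e' c0 C :
  J t1 -> J t2 -> D x1 -> D z -> Rabs (t1 - t2) <= Rabs h / 2 -> Rabs a <= Rabs h / 2 ->
  nrm x1 <= c0 -> nrm z <= c0 -> nrm (A t1 x1) <= C -> nrm (A t2 z) <= C ->
  e' = e [+] (h / 2) [*] (A t1 x1 [-] A t2 z) ->
  e' = x1 [-] z [-] a [*] A t1 x1 ->
  rip e' e' <= rip e e + Rabs h * Rabs h * (L * (C + c0) * c0 + C * C).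
Proof.
  intros J1 J2 Dx Dz Ht Ha Bx Bz Bv Bw E1 E2.
  set (v := A t1 x1) in *. set (w := A t2 z) in *.
  assert (Px := nrm_ge0 x1). assert (Pv := nrm_ge0 v). assert (Ph := Rabs_pos h).
  assert (Pz := nrm_ge0 z). assert (Pw := nrm_ge0 w).
  assert (S1 : rip e' e' <= rip e e + h * rip (v [-] w) e').
  { replace e with (e' [-] (h / 2) [*] (v [-] w)) by (rewrite E1; vec).
    assert (P := Rmult_le_pos _ _ (Rle_0_sqr (h / 2)) (rip_pos (v [-] w))).
    unfold Rsqr in P. revert P. generalize (v [-] w). intros d P. rips.
    rewrite (rip_sym e' d). lra. }
  (* A(t2)(x1 - z) is orthogonal to x1 - z, so A(t2) z may be exchanged for A(t2) x1 in this
     pairing; what remains is a pure time difference of [A]. *)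
  assert (S2 : rip (v [-] w) e' = rip (v [-] A t2 x1) (x1 [-] z) - a * rip (v [-] w) v).
  { assert (Q := rip_A_self _ (HA t2 J2) _ (D_sub _ _ Dx Dz)).
    rewrite (A_sub _ (HA t2 J2)) in Q by assumption. fold w in Q.
    rewrite E2. rewrite rip_sym in Q. revert Q. rips. intro Q. lra. }
  assert (B1 : Rabs (rip (v [-] A t2 x1) (x1 [-] z))
               <= L * (Rabs h / 2) * (C + c0) * (2 * c0)).
  { eapply Rle_trans; [apply cauchy_schwarz |].
    assert (Hl := Hlip t2 t1 x1 J2 J1 Dx). fold v in Hl.
    rewrite (Rabs_minus_sym t2 t1) in Hl. rewrite nrm_sub_sym.
    apply Rmult_le_compat; try apply nrm_ge0.
    - eapply Rle_trans; [exact Hl |]. assert (Pt := Rabs_pos (t1 - t2)).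
      apply Rmult_le_compat; [apply Rmult_le_pos; lra | lra | | lra].
      apply Rmult_le_compat_l; lra.
    - eapply Rle_trans; [apply nrm_sub_le |]. lra. }
  assert (B2 : Rabs (a * rip (v [-] w) v) <= Rabs h / 2 * (2 * C * C)).
  { rewrite Rabs_mult. apply Rmult_le_compat; try apply Rabs_pos; [exact Ha |].
    eapply Rle_trans; [apply cauchy_schwarz |].
    assert (Q := nrm_sub_le v w).
    apply Rmult_le_compat; try apply nrm_ge0; lra. }
  assert (B3 : Rabs (h * rip (v [-] w) e')
               <= Rabs h * (L * (Rabs h / 2) * (C + c0) * (2 * c0) + Rabs h / 2 * (2 * C * C))).
  { rewrite Rabs_mult. apply Rmult_le_compat_l; [exact Ph |]. rewrite S2.
    eapply Rle_trans; [apply Rabs_triang |]. rewrite Rabs_Ropp. lra. }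
  assert (B4 := Rle_abs (h * rip (v [-] w) e')). lra.
Qed.

(** Each coarse step is two uses of [energy_step]: at the midpoint with [a] = h/2, then at the grid
    point with [a] = 0. Both add O(h^2) to an error that starts at 0. *)
Lemma euler_refine s h N x0 C :
  D x0 ->
  (forall j, (j <= 2 * N)%nat -> J (s + INR j * (h / 2))) ->
  (forall j, (j <= N)%nat -> nrm (A (s + INR j * h) (euler s h x0 j)) <= C) ->
  (forall j, (j <= 2 * N)%nat ->
     nrm (A (s + INR j * (h / 2)) (euler s (h / 2) x0 j)) <= C) ->
  forall i, (i <= N)%nat ->
  let e := euler s h x0 i [-] euler s (h / 2) x0 (2 * i) in
  rip e e <= INR i * (2 * (Rabs h * Rabs h * (L * (C + nrm x0) * nrm x0 + C * C))).
Proof.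
  intros Dx0 HJ2 HC HC2.
  assert (Et : forall j, s + INR j * h = s + INR (2 * j) * (h / 2)).
  { intro j. rewrite mult_INR. simpl. field. }
  assert (HJ : forall j, (j <= N)%nat -> J (s + INR j * h)).
  { intros j Hj. rewrite Et. apply HJ2. lia. }
  set (K := Rabs h * Rabs h * (L * (C + nrm x0) * nrm x0 + C * C)).
  set (u := euler s h x0) in *. set (z := euler s (h / 2) x0) in *.
  induction i as [| i IH]; intros Hi e.
  { unfold e. change (2 * 0)%nat with 0%nat. replace (u 0%nat [-] z 0%nat) with 0v
      by (unfold u, z; simpl; vec). rewrite rip_0_r. simpl. lra. }
  specialize (IH ltac:(lia)). cbv zeta in IH.
  set (e0 := u i [-] z (2 * i)%nat) in *.
  set (v := A (s + INR (S i) * h) (u (S i))).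
  (* The error at the midpoint, the coarse scheme being interpolated there with slope [v]. *)
  set (e1 := e0 [+] (h / 2) [*] (v [-] A (s + INR (S (2 * i)) * (h / 2)) (z (S (2 * i))))).
  assert (Eu := euler_eq s h N x0 Dx0 HJ i Hi). fold u v in Eu.
  assert (Ez1 := euler_eq s (h / 2) (2 * N) x0 Dx0 HJ2 (2 * i) ltac:(lia)). fold z in Ez1.
  assert (Ez2 := euler_eq s (h / 2) (2 * N) x0 Dx0 HJ2 (S (2 * i)) ltac:(lia)). fold z in Ez2.
  assert (Ph := Rabs_pos h).
  assert (S1 : rip e1 e1 <= rip e0 e0 + K).
  { apply (energy_step h (s + INR (S i) * h) (s + INR (S (2 * i)) * (h / 2)) (u (S i))
             (z (S (2 * i))) (h / 2)).
    - apply HJ, Hi.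
    - apply HJ2. lia.
    - apply (euler_D s h N); assumption.
    - apply (euler_D s (h / 2) (2 * N)); [assumption | assumption | lia].
    - right. replace (s + INR (S i) * h - (s + INR (S (2 * i)) * (h / 2))) with (h / 2).
      + unfold Rdiv. rewrite Rabs_mult, (Rabs_right (/ 2)) by lra. reflexivity.
      + rewrite !S_INR, mult_INR. simpl. field.
    - right. unfold Rdiv. rewrite Rabs_mult, (Rabs_right (/ 2)) by lra. reflexivity.
    - apply (euler_nrm s h N); assumption.
    - apply (euler_nrm s (h / 2) (2 * N)); [assumption | assumption | lia].
    - apply HC, Hi.
    - apply HC2. lia.
    - reflexivity.
    - fold v. unfold e1, e0. rewrite Eu, Ez1. vec. field. }
  assert (S2 : rip e e <= rip e1 e1 + K).
  { apply (energy_step h (s + INR (S i) * h) (s + INR (2 * S i) * (h / 2)) (u (S i))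
             (z (2 * S i)%nat) 0).
    - apply HJ, Hi.
    - apply HJ2. lia.
    - apply (euler_D s h N); assumption.
    - apply (euler_D s (h / 2) (2 * N)); [assumption | assumption | lia].
    - rewrite <- Et. rewrite Rminus_diag, Rabs_R0. lra.
    - rewrite Rabs_R0. lra.
    - apply (euler_nrm s h N); assumption.
    - apply (euler_nrm s (h / 2) (2 * N)); [assumption | assumption | lia].
    - apply HC, Hi.
    - apply HC2. lia.
    - fold v. unfold e, e1, e0. rewrite Eu, Ez1, Ez2.
      replace (2 * S i)%nat with (S (S (2 * i))) by lia. vec. field.
    - unfold e. vec. }
  rewrite S_INR. lra.
Qed.

(** * Dyadic indices, geometric convergence and weak solutions *)

(** On [0, 1) this is the integer part of th 2^m; at 1 it is 2^m - 1, hence the non-strict upper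
    bound in [bisect_spec]. The recursive form relates the indices of consecutive levels. *)
Fixpoint bisect (th : R) (m : nat) : nat :=
  match m with
  | O => O
  | S m' => let k := bisect th m' in
            if Rle_dec (INR (2 * k + 1)) (th * 2 ^ m) then (2 * k + 1)%nat else (2 * k)%nat
  end.

Lemma bisect_spec th m : 0 <= th <= 1 ->
  INR (bisect th m) <= th * 2 ^ m <= INR (bisect th m) + 1 /\ (bisect th m < 2 ^ m)%nat.
Proof.
  intro Hth. induction m as [| m [IH1 IH2]]; [simpl; split; [lra | lia] |].
  cbn [bisect]. destruct Rle_dec as [H | H].
  - split; [| simpl; lia]. split; [exact H |].
    rewrite plus_INR, mult_INR. simpl. simpl in IH1. lra.
  - split; [| simpl; lia]. apply Rnot_le_lt in H. revert H.
    rewrite plus_INR, mult_INR. simpl. intro. lra.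
Qed.

Lemma bisect_S th m :
  bisect th (S m) = (2 * bisect th m)%nat \/ bisect th (S m) = (2 * bisect th m + 1)%nat.
Proof. cbn [bisect]. destruct Rle_dec; auto. Qed.

Lemma geometric_vlim (u : nat -> V) Q rho : 0 <= rho < 1 ->
  (forall m, nrm (u (S m) [-] u m) <= Q * rho ^ m) -> exists l, vlim u l.
Proof.
  intros Hr Hu.
  assert (B : forall m k, nrm (u (m + k)%nat [-] u m) <= Q * rho ^ m * (1 - rho ^ k) / (1 - rho)).
  { intros m k. induction k as [| k IH].
    { rewrite Nat.add_0_r. replace (u m [-] u m) with 0v by vec. rewrite nrm_0. simpl.
      right. field. lra. }
    rewrite Nat.add_succ_r.
    eapply Rle_trans; [apply (nrm_sub_triangle _ (u (m + k)%nat)) |].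
    specialize (Hu (m + k)%nat).
    replace (Q * rho ^ m * (1 - rho ^ S k) / (1 - rho))
      with (Q * rho ^ (m + k) + Q * rho ^ m * (1 - rho ^ k) / (1 - rho)); [lra |].
    rewrite pow_add. simpl. field. lra. }
  assert (HQ : 0 <= Q).
  { specialize (Hu 0%nat). assert (P := nrm_ge0 (u 1%nat [-] u 0%nat)). simpl in Hu. lra. }
  assert (B' : forall m k, nrm (u (m + k)%nat [-] u m) <= Q / (1 - rho) * rho ^ m).
  { intros m k. eapply Rle_trans; [apply B |].
    assert (P1 := pow_le rho k (proj1 Hr)). assert (P2 := pow_le rho m (proj1 Hr)).
    assert (P3 : 0 < / (1 - rho)) by (apply Rinv_0_lt_compat; lra).
    assert (P4 : 0 <= Q * rho ^ m * / (1 - rho) * rho ^ k)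
      by (repeat apply Rmult_le_pos; lra).
    unfold Rdiv. lra. }
  apply cauchy_vlim. intros eps Heps.
  assert (HQ' : 0 <= Q / (1 - rho)) by (apply Rle_mult_inv_pos; lra).
  destruct (pow_lt_1_zero rho ltac:(rewrite Rabs_right; lra)
              (eps / (2 * (Q / (1 - rho) + 1)))) as [N HN].
  { apply Rdiv_lt_0_compat; lra. }
  specialize (HN N (Nat.le_refl N)). apply Rabs_def2 in HN.
  assert (E : Q / (1 - rho) * rho ^ N < eps / 2).
  { apply Rle_lt_trans with (Q / (1 - rho) * (eps / (2 * (Q / (1 - rho) + 1)))).
    - apply Rmult_le_compat_l; lra.
    - set (q := Q / (1 - rho)) in *.
      apply Rmult_lt_reg_r with (2 * (q + 1)); [lra |].
      replace (q * (eps / (2 * (q + 1))) * (2 * (q + 1))) with (q * eps) by (field; lra).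
      nra. }
  exists N. intros i j Hi Hj.
  assert (Bi := B' N (i - N)%nat). assert (Bj := B' N (j - N)%nat).
  replace (N + (i - N))%nat with i in Bi by lia.
  replace (N + (j - N))%nat with j in Bj by lia.
  assert (T := nrm_sub_triangle (u i) (u N) (u j)). rewrite (nrm_sub_sym (u N)) in T. lra.
Qed.

(** The segment is unordered, so that evolution forwards and backwards in time is treated alike. *)
Definition seg (s b t : R) : Prop := s <= t <= b \/ b <= t <= s.

(** The last clause is the weak equation with a quadratic remainder, whose constant may depend on
    [t] and [psi]; it can therefore be tested with psi = x(t) itself. *)
Definition weak_sol (S : R -> Prop) (x : R -> V) : Prop :=
  (forall t, S t -> D (x t)) /\
  (exists C, forall t t', S t -> S t' -> nrm (x t' [-] x t) <= C * Rabs (t' - t)) /\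
  (forall t psi, S t -> D psi -> exists K, forall t', S t' ->
     Rabs (rip psi (x t' [-] x t) - (t' - t) * rip psi (A t (x t)))
     <= K * ((t' - t) * (t' - t))).

Context (HJc : interval J).

Lemma seg_J s b t : J s -> J b -> seg s b t -> J t.
Proof. intros Js Jb [H | H]; [apply (HJc s t b) | apply (HJc b t s)]; tauto. Qed.

(** * Convergence of the schemes on one segment *)

Section Limit.
Context (s b : R) (x0 : V) (Js : J s) (Jb : J b) (Dx0 : D x0).

Let T := Rabs (b - s).
(** The estimate of [euler_A_bound] at the full length of the segment, with the auxiliary |x0|
    removed again. *)
Let C := exp (L * T) * (nrm (A s x0) + nrm x0) - nrm x0.
Let h m := (b - s) * (/ 2) ^ m.
Let u m := euler s (h m) x0.
Let Tm m := T * (/ 2) ^ m.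

Lemma pow_half m : 0 < (/ 2) ^ m <= 1 /\ (/ 2) ^ m * 2 ^ m = 1.
Proof.
  split; [split; [apply pow_lt; lra | rewrite <- (pow1 m); apply pow_incr; lra] |].
  rewrite <- Rpow_mult_distr. replace (/ 2 * 2) with 1 by lra. apply pow1.
Qed.

Lemma INR_pow2 m : INR (2 ^ m) = 2 ^ m.
Proof. rewrite pow_INR. reflexivity. Qed.

Lemma Rabs_h m : Rabs (h m) = Tm m.
Proof.
  unfold h, Tm, T. destruct (pow_half m). rewrite Rabs_mult, (Rabs_right ((/ 2) ^ m)); lra.
Qed.

Lemma Tm_bounds m : 0 <= Tm m <= T.
Proof.
  destruct (pow_half m) as [H _]. assert (P := Rabs_pos (b - s)). fold T in P.
  unfold Tm. nra.
Qed.

Lemma cv0_Tm : cv0 Tm.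
Proof.
  apply (cv0_scal T (pow (/ 2))). intros eps Heps.
  apply pow_lt_1_zero; [rewrite Rabs_right; lra | exact Heps].
Qed.

Lemma theta_J th : 0 <= th <= 1 -> J (s + th * (b - s)).
Proof.
  intro H. apply (seg_J s b); [exact Js | exact Jb |].
  destruct (Rle_dec s b); [left | right]; nra.
Qed.

Lemma grid_J m j : (j <= 2 ^ m)%nat -> J (s + INR j * h m).
Proof.
  intro Hj. replace (INR j * h m) with (INR j * (/ 2) ^ m * (b - s)) by (unfold h; ring).
  apply theta_J. apply le_INR in Hj. rewrite INR_pow2 in Hj.
  assert (P := pos_INR j). destruct (pow_half m) as [P1 P2]. split; [nra |].
  rewrite <- P2. rewrite (Rmult_comm _ (2 ^ m)). apply Rmult_le_compat_r; lra.
Qed.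

Lemma grid_A_bound m j : (j <= 2 ^ m)%nat -> nrm (A (s + INR j * h m) (u m j)) <= C.
Proof.
  intro Hj. assert (B := euler_A_bound s (h m) (2 ^ m) x0 Dx0 (grid_J m) j Hj).
  fold (u m) in B.
  assert (E : exp (L * (Rabs (h m) * INR j)) <= exp (L * T)).
  { assert (L * (Rabs (h m) * INR j) <= L * T).
    { apply Rmult_le_compat_l; [exact HL |]. rewrite Rabs_h. unfold Tm.
      apply le_INR in Hj. rewrite INR_pow2 in Hj. destruct (pow_half m) as [P1 P2].
      rewrite <- (Rmult_1_r T) at 2. rewrite <- P2, Rmult_assoc.
      apply Rmult_le_compat_l; [apply Rabs_pos |]. apply Rmult_le_compat_l; lra. }
    destruct H as [H | ->]; [left; apply exp_increasing, H | right; reflexivity]. }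
  assert (P1 := nrm_ge0 (A s x0)). assert (P2 := nrm_ge0 x0).
  assert (exp (L * (Rabs (h m) * INR j)) * (nrm (A s x0) + nrm x0)
          <= exp (L * T) * (nrm (A s x0) + nrm x0)) by (apply Rmult_le_compat_r; lra).
  unfold C. lra.
Qed.

Lemma C_ge0 : 0 <= C.
Proof.
  eapply Rle_trans; [apply nrm_ge0 | apply (grid_A_bound 0 0)]. simpl. lia.
Qed.

Lemma grid_lip m i j : (i <= 2 ^ m)%nat -> (j <= 2 ^ m)%nat ->
  nrm (u m j [-] u m i) <= C * (Rabs (INR j - INR i) * Tm m).
Proof.
  assert (B : forall i j, (i <= j)%nat -> (j <= 2 ^ m)%nat ->
            nrm (u m j [-] u m i) <= C * (Rabs (INR j - INR i) * Tm m)).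
  { intros i' j' Hij Hj.
    assert (E := euler_lip s (h m) (2 ^ m) x0 Dx0 (grid_J m) C (grid_A_bound m) i' (j' - i')
                   ltac:(lia)).
    replace (i' + (j' - i'))%nat with j' in E by lia.
    rewrite Rabs_h, minus_INR in E by exact Hij.
    rewrite Rabs_right; [unfold u; lra |]. apply le_INR in Hij. lra. }
  intros Hi Hj. destruct (Nat.le_ge_cases i j) as [H | H]; [apply B; assumption |].
  rewrite nrm_sub_sym, Rabs_minus_sym. apply B; assumption.
Qed.

(** For j below i, [euler_weak] is run from j to i and the sign is reversed; [c] stays attached to
    the same end in both cases. *)
Lemma grid_weak m psi i j c M : D psi -> (i <= 2 ^ m)%nat -> (j <= 2 ^ m)%nat ->
  (forall l, (l <= 2 ^ m)%nat -> Rabs (INR l - INR i) <= Rabs (INR j - INR i) ->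
     Rabs (rip (A (s + INR l * h m) psi) (u m l) - c) <= M) ->
  Rabs (rip psi (u m j [-] u m i) + (INR j - INR i) * h m * c)
  <= Rabs (INR j - INR i) * Tm m * M.
Proof.
  intros Dpsi Hi Hj HM. destruct (Nat.le_ge_cases i j) as [H | H].
  - assert (E := euler_weak s (h m) (2 ^ m) x0 Dx0 (grid_J m) psi i (j - i) c M Dpsi ltac:(lia)).
    replace (i + (j - i))%nat with j in E by lia. fold (u m) in E.
    rewrite minus_INR, Rabs_h in E by exact H.
    assert (Hij := le_INR _ _ H). rewrite (Rabs_right (INR j - INR i)) in * by lra.
    apply E. intros l Hl. apply HM; [lia |].
    assert (INR i <= INR l) by (apply le_INR; lia).
    assert (INR l <= INR j) by (apply le_INR; lia). rewrite Rabs_right; lra.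
  - assert (E := euler_weak s (h m) (2 ^ m) x0 Dx0 (grid_J m) psi j (i - j) c M Dpsi ltac:(lia)).
    replace (j + (i - j))%nat with i in E by lia. fold (u m) in E.
    rewrite minus_INR, Rabs_h in E by exact H.
    assert (Hij := le_INR _ _ H). rewrite (Rabs_left1 (INR j - INR i)) in * by lra.
    replace (rip psi (u m j [-] u m i) + (INR j - INR i) * h m * c)
      with (- (rip psi (u m i [-] u m j) + (INR i - INR j) * h m * c)) by (rips; ring).
    rewrite Rabs_Ropp. replace (- (INR j - INR i)) with (INR i - INR j) by ring.
    apply E. intros l Hl. apply HM; [lia |].
    assert (INR l <= INR i) by (apply le_INR; lia).
    assert (INR j <= INR l) by (apply le_INR; lia). rewrite Rabs_left1; lra.
Qed.

Let ap m th := u m (bisect th m).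

Lemma bisect_le th m : 0 <= th <= 1 -> (bisect th m <= 2 ^ m)%nat.
Proof. intro H. apply Nat.lt_le_incl, bisect_spec, H. Qed.

(** From index k at level m the comparison passes to index 2k at level m + 1, an error O(|h|^(1/2))
    by [euler_refine], and then over at most one fine step, an error O(|h|). With |h| = T 2^(-m)
    both are O(rho^m). *)
Lemma ap_step : exists Q, forall m th, 0 <= th <= 1 ->
  nrm (ap (S m) th [-] ap m th) <= Q * (sqrt (/ 2)) ^ m.
Proof.
  set (rho := sqrt (/ 2)). set (K := 2 * (L * (C + nrm x0) * nrm x0 + C * C)).
  assert (P0 := nrm_ge0 x0). assert (P1 := C_ge0).
  assert (PT : 0 <= T) by apply Rabs_pos.
  assert (HK : 0 <= K).
  { unfold K. assert (0 <= C * C) by (apply Rmult_le_pos; lra).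
    assert (0 <= L * (C + nrm x0) * nrm x0) by (repeat apply Rmult_le_pos; lra). lra. }
  assert (Hrho : 0 <= rho) by apply sqrt_pos.
  assert (Hr2 : forall m, rho ^ m * rho ^ m = (/ 2) ^ m).
  { intro m. rewrite <- Rpow_mult_distr. unfold rho. rewrite sqrt_sqrt by lra. reflexivity. }
  exists (T * sqrt K + C * T). intros m th Hth.
  set (k := bisect th m).
  assert (Hk : (k <= 2 ^ m)%nat) by (apply bisect_le, Hth).
  assert (Hh : h m / 2 = h (S m)) by (unfold h; simpl; field).
  assert (Hpow : (2 * 2 ^ m)%nat = (2 ^ S m)%nat) by reflexivity.
  assert (Pr := pow_le rho m Hrho).
  assert (B1 : nrm (u m k [-] u (S m) (2 * k)%nat) <= T * sqrt K * rho ^ m).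
  { assert (E := euler_refine s (h m) (2 ^ m) x0 C Dx0). rewrite Hh, Hpow in E.
    specialize (E (grid_J (S m)) (grid_A_bound m) (grid_A_bound (S m)) k Hk).
    cbv zeta in E. fold (u m) (u (S m)) in E.
    apply nrm_le; [repeat apply Rmult_le_pos; try apply sqrt_pos; lra |].
    eapply Rle_trans; [exact E |].
    replace (T * sqrt K * rho ^ m * (T * sqrt K * rho ^ m))
      with (T * T * (sqrt K * sqrt K) * (rho ^ m * rho ^ m)) by ring.
    rewrite sqrt_sqrt, Hr2 by exact HK. rewrite Rabs_h. unfold Tm.
    replace (INR k * (2 * (T * (/ 2) ^ m * (T * (/ 2) ^ m)
               * (L * (C + nrm x0) * nrm x0 + C * C))))
      with (INR k * (/ 2) ^ m * (T * T * K * (/ 2) ^ m)) by (unfold K; ring).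
    destruct (pow_half m) as [P2 P3].
    clearbody K. rewrite <- (Rmult_1_l (T * T * K * (/ 2) ^ m)) at 2.
    apply Rmult_le_compat_r; [repeat apply Rmult_le_pos; lra |].
    apply le_INR in Hk. rewrite INR_pow2 in Hk.
    rewrite <- P3, Rmult_comm. apply Rmult_le_compat_l; lra. }
  assert (B2 : nrm (ap (S m) th [-] u (S m) (2 * k)%nat) <= C * T * rho ^ m).
  { unfold ap. assert (Hle := bisect_le th (S m) Hth).
    eapply Rle_trans; [apply grid_lip; [rewrite <- Hpow; lia | exact Hle] |].
    rewrite Rmult_assoc. apply Rmult_le_compat_l; [exact P1 |].
    assert (Hd : Rabs (INR (bisect th (S m)) - INR (2 * k)) <= 1).
    { destruct (bisect_S th m) as [-> | ->]; fold k.
      - rewrite Rminus_diag, Rabs_R0. lra.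
      - rewrite plus_INR. simpl (INR 1). rewrite Rabs_right; lra. }
    assert (Hm : (/ 2) ^ S m <= rho ^ m).
    { destruct (pow_half m) as [P2 _]. simpl. rewrite <- Hr2 in *.
      assert (rho ^ m <= 1) by nra. nra. }
    destruct (Tm_bounds (S m)) as [P2 _]. unfold Tm in *.
    apply Rle_trans with (1 * (T * (/ 2) ^ S m)).
    - apply Rmult_le_compat_r; assumption.
    - rewrite Rmult_1_l. apply Rmult_le_compat_l; assumption. }
  eapply Rle_trans; [apply (nrm_sub_triangle _ (u (S m) (2 * k)%nat)) |].
  rewrite (nrm_sub_sym (u (S m) (2 * k)%nat)). fold k in B1. unfold ap in *. fold k. lra.
Qed.

(** The limit is a function of the parameter [th] in [0, 1], standing for the time s + th (b - s),
    so neither orientation needs its own construction. *)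
Let xl th := epsilon (inhabits 0v) (vlim (fun m => ap m th)).

Lemma xl_lim th : 0 <= th <= 1 -> vlim (fun m => ap m th) (xl th).
Proof.
  intro Hth. apply epsilon_spec. destruct ap_step as [Q HQ].
  apply (geometric_vlim _ Q (sqrt (/ 2))); [| intro m; apply HQ, Hth].
  split; [apply sqrt_pos |]. rewrite <- sqrt_1. apply sqrt_lt_1_alt. lra.
Qed.

Lemma xl_0 : xl 0 = x0.
Proof.
  assert (E : forall m, ap m 0 = x0).
  { intro m. unfold ap. replace (bisect 0 m) with 0%nat; [reflexivity |].
    destruct (bisect_spec 0 m ltac:(lra)) as [[B _] _]. rewrite Rmult_0_l in B.
    symmetry. apply INR_eq. assert (P := pos_INR (bisect 0 m)). simpl. lra. }
  apply nrm_sub_eq.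
  apply (cv0_le _ _ (fun m => nrm (ap m 0 [-] xl 0))); [| apply xl_lim; lra].
  intro m. rewrite E, nrm_sub_sym. lra.
Qed.

Lemma bisect_dist m th th' : 0 <= th <= 1 -> 0 <= th' <= 1 ->
  Rabs ((INR (bisect th' m) - INR (bisect th m)) * h m - (th' - th) * (b - s)) <= 2 * Tm m /\
  Rabs (INR (bisect th' m) - INR (bisect th m)) * Tm m
    <= Rabs ((th' - th) * (b - s)) + 2 * Tm m.
Proof.
  intros H H'. destruct (bisect_spec th m H) as [B _]. destruct (bisect_spec th' m H') as [B' _].
  set (k := INR (bisect th m)) in *. set (k' := INR (bisect th' m)) in *.
  assert (E : Rabs ((k' - k) * h m - (th' - th) * (b - s)) <= 2 * Tm m).
  { replace ((k' - k) * h m - (th' - th) * (b - s))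
      with ((k' - k - (th' - th) * 2 ^ m) * h m).
    - rewrite Rabs_mult, Rabs_h. apply Rmult_le_compat_r; [apply Tm_bounds |].
      apply Rabs_le. lra.
    - unfold h. destruct (pow_half m) as [_ P].
      replace ((k' - k - (th' - th) * 2 ^ m) * ((b - s) * (/ 2) ^ m))
        with ((k' - k) * ((b - s) * (/ 2) ^ m)
              - (th' - th) * (b - s) * ((/ 2) ^ m * 2 ^ m)) by ring.
      rewrite P. ring. }
  split; [exact E |].
  rewrite <- Rabs_h, <- Rabs_mult.
  assert (Q := Rabs_triang ((k' - k) * h m - (th' - th) * (b - s)) ((th' - th) * (b - s))).
  replace ((k' - k) * h m - (th' - th) * (b - s) + (th' - th) * (b - s))
    with ((k' - k) * h m) in Q by ring. rewrite Rabs_h. lra.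
Qed.

Lemma xl_lip th th' : 0 <= th <= 1 -> 0 <= th' <= 1 ->
  nrm (xl th' [-] xl th) <= C * Rabs ((th' - th) * (b - s)).
Proof.
  intros H H'.
  apply (cv0_le _ _ (fun m =>
    2 * C * Tm m + (nrm (ap m th' [-] xl th') + nrm (ap m th [-] xl th)))).
  - intro m. assert (B := grid_lip m _ _ (bisect_le th m H) (bisect_le th' m H')).
    fold (ap m th) (ap m th') in B.
    destruct (bisect_dist m th th' H H') as [_ B2].
    assert (B3 := Rmult_le_compat_l _ _ _ C_ge0 B2).
    assert (T1 := nrm_sub_triangle (xl th') (ap m th') (xl th)).
    assert (T2 := nrm_sub_triangle (ap m th') (ap m th) (xl th)).
    rewrite (nrm_sub_sym (xl th') (ap m th')) in T1. lra.
  - apply cv0_plus; [apply cv0_scal, cv0_Tm |]. apply cv0_plus; apply xl_lim; assumption.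
Qed.

Lemma grid_time m th l : 0 <= th <= 1 ->
  Rabs (s + INR l * h m - (s + th * (b - s))) <= Rabs (INR l - INR (bisect th m)) * Tm m + Tm m.
Proof.
  intro H. destruct (bisect_spec th m H) as [B _]. set (k := INR (bisect th m)) in *.
  replace (s + INR l * h m - (s + th * (b - s)))
    with ((INR l - k) * h m + (k - th * 2 ^ m) * h m).
  - eapply Rle_trans; [apply Rabs_triang |]. rewrite !Rabs_mult, Rabs_h.
    assert (Rabs (k - th * 2 ^ m) <= 1) by (apply Rabs_le; lra).
    assert (P := proj1 (Tm_bounds m)).
    assert (Rabs (k - th * 2 ^ m) * Tm m <= 1 * Tm m) by (apply Rmult_le_compat_r; lra). lra.
  - unfold h. destruct (pow_half m) as [_ P].
    replace ((INR l - k) * ((b - s) * (/ 2) ^ m) + (k - th * 2 ^ m) * ((b - s) * (/ 2) ^ m))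
      with (INR l * ((b - s) * (/ 2) ^ m) - th * (b - s) * ((/ 2) ^ m * 2 ^ m)) by ring.
    rewrite P. ring.
Qed.

(** [D_closed] needs one fixed operator: the bound on [A] at the moving grid times is transferred to
    the time [t] by [Hlip]. *)
Lemma xl_D th : 0 <= th <= 1 -> D (xl th).
Proof.
  intro H. set (t := s + th * (b - s)).
  assert (Jt : J t) by (apply theta_J, H).
  apply (D_closed (A t) (HA t Jt) (fun m => ap m th) (C + L * T * (C + nrm x0)));
    [| | apply xl_lim, H]; intro m; assert (Hk := bisect_le th m H).
  { apply (euler_D s (h m) (2 ^ m)); [exact Dx0 | apply grid_J | exact Hk]. }
  set (k := bisect th m) in *.
  assert (Jk := grid_J m k Hk).
  assert (Dk : D (u m k))
    by (apply (euler_D s (h m) (2 ^ m)); [exact Dx0 | apply grid_J | exact Hk]).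
  assert (B1 := grid_A_bound m k Hk).
  assert (B2 : nrm (u m k) <= nrm x0)
    by (apply (euler_nrm s (h m) (2 ^ m)); [exact Dx0 | apply grid_J | exact Hk]).
  assert (B3 := Hlip t _ _ Jt Jk Dk).
  assert (B4 := grid_time m th k H). fold t k in B4. rewrite Rminus_diag, Rabs_R0 in B4.
  assert (B5 := Tm_bounds m). rewrite Rabs_minus_sym in B4.
  unfold ap. fold k.
  eapply Rle_trans; [apply (nrm_le_sub _ (A (s + INR k * h m) (u m k))) |].
  apply Rplus_le_compat; [exact B1 |]. eapply Rle_trans; [exact B3 |].
  assert (P1 := nrm_ge0 (A (s + INR k * h m) (u m k))). assert (P2 := nrm_ge0 (u m k)).
  apply Rmult_le_compat; [apply Rmult_le_pos; [exact HL | apply Rabs_pos] | lra | | lra].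
  apply Rmult_le_compat_l; lra.
Qed.

(** The limit of [grid_weak]. Between the two times <A psi, u> deviates from its value at [t]
    because A psi changes, contributing L (|A(t) psi| + |psi|) |x0| per unit of time, and because
    [u] moves, contributing |A(t) psi| C. Summation over a length |d| makes this quadratic in
    [d]. *)
Lemma xl_weak th th' psi : 0 <= th <= 1 -> 0 <= th' <= 1 -> D psi ->
  let t := s + th * (b - s) in
  let d := (th' - th) * (b - s) in
  Rabs (rip psi (xl th' [-] xl th) - d * rip psi (A t (xl th)))
  <= (L * (nrm (A t psi) + nrm psi) * nrm x0 + nrm (A t psi) * C) * (d * d).
Proof.
  intros H H' Dpsi t d.
  assert (Jt : J t) by (apply theta_J, H).
  set (G := nrm (A t psi) + nrm psi). set (a := nrm (A t psi)). set (z := xl th).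
  set (c := rip (A t psi) z).
  assert (Ec : rip psi (A t z) = - c).
  { apply (A_skew (A t) (HA t Jt)); [exact Dpsi | apply xl_D, H]. }
  rewrite Ec. set (K := L * G * nrm x0 + a * C).
  assert (Pa : 0 <= a) by apply nrm_ge0. assert (P0 := nrm_ge0 x0). assert (PC := C_ge0).
  assert (PG : 0 <= G) by (assert (Q := nrm_ge0 psi); unfold G; fold a; lra).
  assert (Pd := Rabs_pos d).
  assert (PLG : 0 <= L * G) by (apply Rmult_le_pos; assumption).
  assert (PK : 0 <= K) by (apply Rplus_le_le_0_compat; apply Rmult_le_pos; assumption).
  set (e := fun m => nrm (ap m th [-] z)). set (e' := fun m => nrm (ap m th' [-] xl th')).
  (* The error collects the mesh size and the distances of the approximants from their limits. The
     coefficients 5 and 6 come from (|d| + 2 Tm)(|d| + 3 Tm) with Tm <= T. *)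
  apply (cv0_le _ _ (fun m => (K * (5 * Rabs d + 6 * T) + 2 * Rabs c) * Tm m
                      + ((a * (Rabs d + 2 * T) + nrm psi) * e m + nrm psi * e' m))).
  2:{ apply cv0_plus; [apply cv0_scal, cv0_Tm |].
      apply cv0_plus; apply cv0_scal, xl_lim; assumption. }
  intro m.
  set (k := bisect th m). set (k' := bisect th' m).
  assert (Hk : (k <= 2 ^ m)%nat) by (apply bisect_le, H).
  assert (Hk' : (k' <= 2 ^ m)%nat) by (apply bisect_le, H').
  destruct (bisect_dist m th th' H H') as [B1 B2]. fold k k' d in B1, B2.
  destruct (Tm_bounds m) as [B3 B4].
  assert (Pe : 0 <= e m) by apply nrm_ge0. assert (Pe' : 0 <= e' m) by apply nrm_ge0.
  (* By [B2], [w] bounds the time between the two grid points. *)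
  set (w := Rabs d + 2 * Tm m) in *.
  assert (Pw : 0 <= w) by (unfold w; lra).
  assert (W := grid_weak m psi k k' c (K * (w + Tm m) + a * e m) Dpsi Hk Hk').
  assert (W' : Rabs (rip psi (u m k' [-] u m k) + (INR k' - INR k) * h m * c)
               <= w * (K * (w + Tm m) + a * e m)).
  { eapply Rle_trans; [apply W |].
    2:{ apply Rmult_le_compat_r; [| exact B2].
        apply Rplus_le_le_0_compat; apply Rmult_le_pos; lra. }
    intros l Hl Hlk.
    assert (Jl := grid_J m l Hl).
    assert (C1 := grid_time m th l H). fold t k in C1.
    assert (C2 := Rmult_le_compat_r _ _ _ B3 Hlk).
    assert (C3 := Hlip _ t psi Jl Jt Dpsi). fold G in C3.
    assert (C4 : nrm (A (s + INR l * h m) psi [-] A t psi) <= L * G * (w + Tm m)).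
    { eapply Rle_trans; [exact C3 |].
      rewrite Rmult_assoc, (Rmult_comm (Rabs _)), <- Rmult_assoc.
      apply Rmult_le_compat_l; [exact PLG | lra]. }
    assert (C5 : nrm (u m l) <= nrm x0)
      by (apply (euler_nrm s (h m) (2 ^ m)); [exact Dx0 | apply grid_J | exact Hl]).
    assert (C6 : nrm (u m l [-] z) <= C * w + e m).
    { eapply Rle_trans; [apply (nrm_sub_triangle _ (u m k)) |].
      apply Rplus_le_compat; [| apply Rle_refl].
      eapply Rle_trans; [apply grid_lip; assumption |].
      apply Rmult_le_compat_l; [exact PC | lra]. }
    replace (rip (A (s + INR l * h m) psi) (u m l) - c)
      with (rip (A (s + INR l * h m) psi [-] A t psi) (u m l) + rip (A t psi) (u m l [-] z))
      by (unfold c; rips; ring).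
    eapply Rle_trans; [apply Rabs_triang |].
    assert (C7 := cauchy_schwarz (A (s + INR l * h m) psi [-] A t psi) (u m l)).
    assert (C8 := cauchy_schwarz (A t psi) (u m l [-] z)). fold a in C8.
    assert (C9 := Rmult_le_compat _ _ _ _ (nrm_ge0 _) (nrm_ge0 _) C4 C5).
    assert (C10 := Rmult_le_compat_l _ _ _ Pa C6).
    assert (0 <= a * C * Tm m) by (apply Rmult_le_pos; [apply Rmult_le_pos |]; assumption).
    unfold K. lra. }
  set (y := rip psi (u m k' [-] u m k)) in *.
  assert (X1 : Rabs (y + d * c) <= w * (K * (w + Tm m) + a * e m) + 2 * Tm m * Rabs c).
  { replace (y + d * c) with ((y + (INR k' - INR k) * h m * c)
                              + - (((INR k' - INR k) * h m - d) * c)) by ring.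
    eapply Rle_trans; [apply Rabs_triang |]. rewrite Rabs_Ropp, Rabs_mult.
    assert (Q := Rmult_le_compat_r _ _ _ (Rabs_pos c) B1). lra. }
  assert (X2 : Rabs (rip psi (xl th' [-] z) - d * - c)
               <= Rabs (y + d * c) + nrm psi * (e m + e' m)).
  { replace (rip psi (xl th' [-] z) - d * - c)
      with ((y + d * c) + (rip psi (u m k [-] z) + - rip psi (u m k' [-] xl th')))
      by (unfold y; rips; ring).
    eapply Rle_trans; [apply Rabs_triang |].
    assert (Q := Rabs_triang (rip psi (u m k [-] z)) (- rip psi (u m k' [-] xl th'))).
    rewrite Rabs_Ropp in Q.
    assert (Q1 := cauchy_schwarz psi (u m k [-] z)).
    assert (Q2 := cauchy_schwarz psi (u m k' [-] xl th')).
    unfold e, e', ap. fold k k'. lra. }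
  assert (Edd : d * d = Rabs d * Rabs d) by apply sq_Rabs.
  rewrite Edd.
  assert (X3 : w * (w + Tm m) <= Rabs d * Rabs d + (5 * Rabs d + 6 * T) * Tm m).
  { unfold w. assert (Tm m * Tm m <= T * Tm m) by (apply Rmult_le_compat_r; lra). lra. }
  assert (X4 : w * e m <= (Rabs d + 2 * T) * e m) by (apply Rmult_le_compat_r; unfold w; lra).
  assert (X5 := Rmult_le_compat_l _ _ _ PK X3).
  assert (X6 := Rmult_le_compat_l _ _ _ Pa X4).
  lra.
Qed.

Lemma weak_sol_exists : exists x,
  weak_sol (seg s b) x /\ x s = x0 /\
  (forall t, seg s b t -> nrm (x t [-] x0) <= C * Rabs (t - s)) /\
  (forall t psi, seg s b t -> D psi ->
     Rabs (rip psi (x t [-] x0) - (t - s) * rip psi (A s x0))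
     <= (L * (nrm (A s psi) + nrm psi) * nrm x0 + nrm (A s psi) * C) * ((t - s) * (t - s))).
Proof.
  set (th t := (t - s) / (b - s)).
  assert (Hth : forall t, seg s b t -> 0 <= th t <= 1 /\ s + th t * (b - s) = t).
  { intros t Ht. unfold th. destruct (Req_dec b s) as [-> | Hbs].
    { replace t with s by (destruct Ht; lra). unfold Rdiv. rewrite Rminus_diag. lra. }
    assert (E : (t - s) / (b - s) * (b - s) = t - s) by (field; lra).
    split; [| lra]. set (r := (t - s) / (b - s)) in *. destruct Ht; nra. }
  assert (Hs : seg s b s) by (unfold seg; destruct (Rle_dec s b); lra).
  assert (th0 : th s = 0) by (unfold th, Rdiv; rewrite Rminus_diag; ring).
  assert (Hd : forall t t', seg s b t -> seg s b t' -> (th t' - th t) * (b - s) = t' - t).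
  { intros t t' Ht Ht'. destruct (Hth t Ht). destruct (Hth t' Ht'). lra. }
  assert (W : forall t t' psi, seg s b t -> seg s b t' -> D psi ->
     Rabs (rip psi (xl (th t') [-] xl (th t)) - (t' - t) * rip psi (A t (xl (th t))))
     <= (L * (nrm (A t psi) + nrm psi) * nrm x0 + nrm (A t psi) * C)
        * ((t' - t) * (t' - t))).
  { intros t t' psi Ht Ht' Dpsi. destruct (Hth t Ht) as [H1 H2].
    destruct (Hth t' Ht') as [H1' _].
    assert (B := xl_weak (th t) (th t') psi H1 H1' Dpsi). cbv zeta in B.
    rewrite (Hd t t' Ht Ht'), H2 in B. exact B. }
  assert (Lip : forall t t', seg s b t -> seg s b t' ->
     nrm (xl (th t') [-] xl (th t)) <= C * Rabs (t' - t)).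
  { intros t t' Ht Ht'. rewrite <- (Hd t t' Ht Ht').
    apply xl_lip; apply Hth; assumption. }
  assert (X0 : xl (th s) = x0) by (rewrite th0; apply xl_0).
  exists (fun t => xl (th t)). split; [| split; [exact X0 | split]].
  - split; [| split].
    + intros t Ht. apply xl_D, Hth, Ht.
    + exists C. exact Lip.
    + intros t psi Ht Dpsi. eexists. intros t' Ht'. apply W; assumption.
  - intros t Ht. rewrite <- X0. apply Lip; assumption.
  - intros t psi Ht Dpsi. specialize (W s t psi Hs Ht Dpsi). rewrite X0 in W. exact W.
Qed.

End Limit.

End Evolution.

(** * Weak solutions and the propagator *)

Section Propagator.
Context (A : R -> V -> V) (I : R -> Prop) (HI : interval I)
  (HA : forall t, I t -> skew_adjoint (A t))
  (Hloc : forall p q, I p -> I q -> p <= q -> exists L, 0 <= L /\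
     forall t s x, p <= t <= q -> p <= s <= q -> D x ->
       nrm (A t x [-] A s x) <= L * Rabs (t - s) * (nrm (A s x) + nrm x))
  (Hdense : dense HS D).

Lemma vadd_vsub_vsub x y x' y' : (x [+] y) [-] (x' [+] y') = (x [-] x') [+] (y [-] y').
Proof. vec. Qed.

(** The complex scalar passes to the test vector as its conjugate, and the multiple of [psi] so
    obtained is again in [D]. *)
Lemma weak_sol_lin S c x y : (forall t, S t -> I t) ->
  weak_sol A S x -> weak_sol A S y -> weak_sol A S (fun t => vscal HS c (x t) [+] y t).
Proof.
  intros HSI (Dx & (Cx & Lx) & Wx) (Dy & (Cy & Ly) & Wy).
  assert (Es : forall v w, vscal HS c v [-] vscal HS c w = vscal HS c (v [-] w)).
  { intros v w. apply rip_ext. intro z. rips.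
    rewrite !(rip_vscal_r c), <- (Ropp_involutive (rip z (vscal HS Ci (v [+] _)))), <- rip_Ci_l.
    rips. rewrite !rip_Ci_l. ring. }
  assert (Er : forall z v, rip z (vscal HS c v) = rip (vscal HS (Cconj c) z) v).
  { intros z v. rewrite rip_vscal_r, rip_vscal_l. simpl. ring. }
  split; [| split].
  - intros t Ht. apply D_lin; auto.
  - exists ((Rabs (Cre c) + Rabs (Cim c)) * Cx + Cy). intros t t' Ht Ht'.
    rewrite vadd_vsub_vsub, Es. eapply Rle_trans; [apply nrm_triangle |].
    assert (B := nrm_vscal_le c (x t' [-] x t)).
    assert (P1 := Rabs_pos (Cre c)). assert (P2 := Rabs_pos (Cim c)).
    assert (B2 := Rmult_le_compat_l (Rabs (Cre c) + Rabs (Cim c)) _ _ ltac:(lra)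
                    (Lx t t' Ht Ht')).
    specialize (Ly t t' Ht Ht'). lra.
  - intros t psi Ht Dpsi.
    destruct (Wx t (vscal HS (Cconj c) psi) Ht (D_vscal _ _ Dpsi)) as [Kx HKx].
    destruct (Wy t psi Ht Dpsi) as [Ky HKy].
    exists (Kx + Ky). intros t' Ht'. specialize (HKx t' Ht'). specialize (HKy t' Ht').
    rewrite (proj1 (HA t (HSI t Ht))) by auto.
    rewrite vadd_vsub_vsub, Es, !rip_add_r, !Er.
    match type of HKx with Rabs ?a <= _ => match type of HKy with Rabs ?b <= _ =>
      assert (Q := Rabs_triang a b) end end.
    eapply Rle_trans; [| eapply Rle_trans; [exact Q |]]; [right; f_equal; ring | lra].
Qed.

Lemma weak_sol_sub S S' x : (forall t, S' t -> S t) -> weak_sol A S x -> weak_sol A S' x.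
Proof.
  intros HSI (Dx & (C & Lx) & W). split; [auto |]. split; [exists C; auto |].
  intros t psi Ht Dpsi. destruct (W t psi (HSI t Ht) Dpsi) as [K HK]. exists K. auto.
Qed.

(** |x(t')|^2 - |x(t)|^2 = 2 <x(t), x(t') - x(t)> + |x(t') - x(t)|^2. The first term is quadratic by
    the weak equation tested with x(t) and skewness, the second by the Lipschitz bound. *)
Lemma weak_sol_nrm S x t t' : interval S -> (forall t, S t -> I t) -> weak_sol A S x ->
  S t -> S t' -> nrm (x t') = nrm (x t).
Proof.
  intros HSc HSI (Dx & (C & Lx) & W).
  assert (B : forall t t', S t -> S t' -> t <= t' -> rip (x t') (x t') = rip (x t) (x t)).
  { clear t t'. intros p q Sp Sq Hpq.
    assert (HSpq : forall t, p <= t <= q -> S t) by (intros r Hr; apply (HSc p r q); tauto).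
    assert (M : Rabs (rip (x q) (x q) - rip (x p) (x p)) <= 0 * (q - p)).
    { apply (mean_value_within S (fun t => rip (x t) (x t))); [exact Hpq | exact HSpq |].
      intros t Ht. exists 0. split; [rewrite Rabs_R0; lra |].
      assert (St := HSpq t Ht).
      destruct (W t (x t) St (Dx t St)) as [K HK].
      apply (deriv_within_quadratic _ _ _ (2 * K + C * C)). intros t' St'.
      specialize (HK t' St'). specialize (Lx t t' St St').
      rewrite (rip_A_self _ (HA t (HSI t St)) _ (Dx t St)), Rmult_0_r, Rminus_0_r in HK.
      replace (rip (x t') (x t') - rip (x t) (x t))
        with (2 * rip (x t) (x t' [-] x t) + rip (x t' [-] x t) (x t' [-] x t))
        by (rips; rewrite (rip_sym (x t') (x t)); ring).
      eapply Rle_trans; [apply Rabs_triang |].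
      rewrite Rabs_mult, (Rabs_right 2), (Rabs_right (rip (x t' [-] x t) _)), <- nrm_sq
        by (try apply Rle_ge, rip_pos; lra).
      assert (P := nrm_ge0 (x t' [-] x t)).
      assert (Q := Rmult_le_compat _ _ _ _ P P Lx Lx).
      assert (E : (t' - t) * (t' - t) = Rabs (t' - t) * Rabs (t' - t))
        by apply sq_Rabs.
      rewrite E in *. lra. }
    rewrite Rmult_0_l in M. apply Rabs_le_inv in M. lra. }
  intros St St'. unfold vnorm. f_equal. change (rip (x t') (x t') = rip (x t) (x t)).
  destruct (Rle_dec t t'); [apply B; assumption | symmetry; apply B; lra || assumption].
Qed.

(** The difference is again a weak solution and keeps the norm 0 it has at [t]. *)
Lemma weak_sol_unique S x y t t' : interval S -> (forall t, S t -> I t) ->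
  weak_sol A S x -> weak_sol A S y -> S t -> S t' -> x t = y t -> x t' = y t'.
Proof.
  intros HSc HSI Wx Wy St St' E.
  assert (W := weak_sol_lin S (RtoC (-1)) y x HSI Wy Wx).
  assert (N := weak_sol_nrm S _ t t' HSc HSI W St St'). cbv beta in N.
  fold (rscal (-1) (y t)) (rscal (-1) (y t')) in N. rewrite <- !vsub_eq_lin in N.
  apply nrm_sub_eq. rewrite N, E. replace (y t [-] y t) with 0v by vec. rewrite nrm_0. lra.
Qed.

Lemma seg_interval s b : interval (seg s b).
Proof. intros a c d Ha Hd H1 H2. unfold seg in *. lra. Qed.

Lemma seg_I s b t : I s -> I b -> seg s b t -> I t.
Proof. apply seg_J, HI. Qed.

Lemma seg_l s b : seg s b s.
Proof. unfold seg. destruct (Rle_dec s b); lra. Qed.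

Lemma seg_r s b : seg s b b.
Proof. unfold seg. destruct (Rle_dec s b); lra. Qed.

(** * The evolution on [D] as a relation *)

(** The graph of U(t, s) restricted to [D], with the later argument order of the propagator. *)
Definition evo (t s : R) (x y : V) : Prop :=
  exists w, weak_sol A (seg s t) w /\ w s = x /\ w t = y.

(* C(|t-s|) tends to |A(s) x| as t -> s; this is what turns weak into strong
   differentiability at the initial time. *)
Lemma evo_exists_local p q s t x L :
  I p -> I q -> p <= s <= q -> p <= t <= q -> D x -> 0 <= L ->
  (forall t s x, p <= t <= q -> p <= s <= q -> D x ->
       nrm (A t x [-] A s x) <= L * Rabs (t - s) * (nrm (A s x) + nrm x)) ->
  let C := exp (L * Rabs (t - s)) * (nrm (A s x) + nrm x) - nrm x in
  exists y, evo t s x y /\ nrm (y [-] x) <= C * Rabs (t - s) /\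
  forall psi, D psi ->
     Rabs (rip psi (y [-] x) - (t - s) * rip psi (A s x))
     <= (L * (nrm (A s psi) + nrm psi) * nrm x + nrm (A s psi) * C) * ((t - s) * (t - s)).
Proof.
  intros Ip Iq Hs Ht Dx HL Hlip.
  destruct (weak_sol_exists A (fun r => p <= r <= q) L HL) with (s := s) (b := t) (x0 := x)
    as (w & Hw & Hws & Hlipw & Hweak); try assumption.
  - intros r Hr. apply HA, (HI p r q); tauto.
  - intros a b c Ha Hc. lra.
  - exists (w t). split; [exists w; auto |].
    split; [apply Hlipw, seg_r | intros psi Dpsi; apply Hweak; [apply seg_r | exact Dpsi]].
Qed.

Lemma evo_exists t s x : I t -> I s -> D x -> exists y, evo t s x y.
Proof.
  intros It Is Dx. destruct (Rle_dec s t) as [H | H].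
  - destruct (Hloc s t Is It H) as [L [HL Hlip]].
    destruct (evo_exists_local s t s t x L) as [y [Hy _]]; try assumption; try lra. eauto.
  - destruct (Hloc t s It Is ltac:(lra)) as [L [HL Hlip]].
    destruct (evo_exists_local t s s t x L) as [y [Hy _]]; try assumption; try lra. eauto.
Qed.

Lemma evo_D t s x y : evo t s x y -> D x /\ D y.
Proof.
  intros (w & (Dw & _) & <- & <-). split; apply Dw; [apply seg_l | apply seg_r].
Qed.

Lemma evo_unique t s x y y' : I t -> I s -> evo t s x y -> evo t s x y' -> y = y'.
Proof.
  intros It Is (w & Hw & Hws & <-) (w' & Hw' & Hws' & <-).
  apply (weak_sol_unique (seg s t) w w' s t); auto using seg_interval, seg_l, seg_r.
  - intros r. apply seg_I; assumption.
  - congruence.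
Qed.

Lemma evo_sym t s x y : evo t s x y -> evo s t y x.
Proof.
  intros (w & Hw & Hws & Hwt). exists w. split; [| auto].
  apply (weak_sol_sub (seg s t)); [| exact Hw]. unfold seg. tauto.
Qed.

Lemma evo_id t x : I t -> D x -> evo t t x x.
Proof.
  intros It Dx. destruct (evo_exists t t x It It Dx) as [y (w & Hw & Hwx & Hwy)].
  exists w. auto.
Qed.

Lemma evo_lin t s c x y x' y' : I t -> I s -> evo t s x y -> evo t s x' y' ->
  evo t s (vscal HS c x [+] x') (vscal HS c y [+] y').
Proof.
  intros It Is (w & Hw & <- & <-) (w' & Hw' & <- & <-).
  exists (fun r => vscal HS c (w r) [+] w' r). split; [| auto].
  apply weak_sol_lin; auto. intros r. apply seg_I; assumption.
Qed.

Lemma evo_sub t s x y x' y' : I t -> I s -> evo t s x y -> evo t s x' y' ->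
  evo t s (x [-] x') (y [-] y').
Proof. rewrite !vsub_eq_lin. intros. apply evo_lin; assumption. Qed.

Lemma evo_nrm t s x y : I t -> I s -> evo t s x y -> nrm y = nrm x.
Proof.
  intros It Is (w & Hw & <- & <-).
  apply (weak_sol_nrm (seg s t)); auto using seg_interval, seg_l, seg_r.
  intros r. apply seg_I; assumption.
Qed.

Lemma evo_split t s r x y : seg s t r -> evo t s x y -> exists z, evo r s x z /\ evo t r z y.
Proof.
  intros Hr (w & Hw & Hws & Hwt). exists (w r). split.
  - exists w. split; [| auto]. apply (weak_sol_sub (seg s t)); [| exact Hw].
    unfold seg in *. intros. lra.
  - exists w. split; [| auto]. apply (weak_sol_sub (seg s t)); [| exact Hw].
    unfold seg in *. intros. lra.
Qed.

(** One of the three times lies between the other two. The evolution across the outer pair is split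
    there, and its pieces, reversed where necessary, are identified by uniqueness. *)
Lemma evo_comp r s t x y z : I r -> I s -> I t ->
  evo s t x y -> evo r s y z -> evo r t x z.
Proof.
  intros Ir Is It H1 H2.
  assert (Cs : seg t r s \/ seg t s r \/ seg s r t) by (unfold seg; lra).
  destruct Cs as [Hs | [Hr | Ht]].
  - destruct (evo_exists r t x Ir It (proj1 (evo_D _ _ _ _ H1))) as [z' Hz'].
    destruct (evo_split _ _ _ _ _ Hs Hz') as [y' [Hy1 Hy2]].
    rewrite <- (evo_unique _ _ _ _ _ Is It H1 Hy1) in Hy2.
    rewrite (evo_unique _ _ _ _ _ Ir Is H2 Hy2). exact Hz'.
  - destruct (evo_split _ _ _ _ _ Hr H1) as [w [Hw1 Hw2]].
    rewrite (evo_unique _ _ _ _ _ Ir Is H2 (evo_sym _ _ _ _ Hw2)). exact Hw1.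
  - destruct (evo_split _ _ _ _ _ Ht H2) as [w [Hw1 Hw2]].
    rewrite (evo_unique _ _ _ _ _ It Is (evo_sym _ _ _ _ H1) Hw1). exact Hw2.
Qed.

(** * Strong differentiability and continuity at the initial time *)

(** Provides one compact interval, hence one Lipschitz constant, for all times of [I] near [s]. At
    an end of [I] the point [s] itself serves as [p] or [q], and the radius 1 is arbitrary. *)
Lemma interval_nbhd s : I s -> exists p q delta, I p /\ I q /\ p <= s <= q /\ delta > 0 /\
  forall t, I t -> Rabs (t - s) < delta -> p <= t <= q.
Proof.
  intro Is.
  assert (Hp : exists p d, I p /\ p <= s /\ d > 0 /\ forall t, I t -> s - t < d -> p <= t).
  { destruct (classic (exists p, I p /\ p < s)) as [[p [Ip Hp]] | Hno].
    - exists p, (s - p). repeat split; try assumption; try lra. intros. lra.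
    - exists s, 1. repeat split; try assumption; try lra.
      intros t It _. apply Rnot_lt_le. eauto. }
  assert (Hq : exists q d, I q /\ s <= q /\ d > 0 /\ forall t, I t -> t - s < d -> t <= q).
  { destruct (classic (exists q, I q /\ s < q)) as [[q [Iq Hq]] | Hno].
    - exists q, (q - s). repeat split; try assumption; try lra. intros. lra.
    - exists s, 1. repeat split; try assumption; try lra.
      intros t It _. apply Rnot_lt_le. eauto. }
  destruct Hp as (p & d & Ip & Hp & Hd & Bp). destruct Hq as (q & d' & Iq & Hq & Hd' & Bq).
  exists p, q, (Rmin d d'). split; [exact Ip |]. split; [exact Iq |]. split; [lra |].
  split; [apply Rmin_pos; lra |].
  intros t It Ht. apply Rabs_def2 in Ht. assert (M1 := Rmin_l d d'). assert (M2 := Rmin_r d d').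
  split; [apply Bp | apply Bq]; auto; lra.
Qed.

Lemma evo_deriv s x eps : I s -> D x -> eps > 0 -> exists delta, delta > 0 /\
  forall h y, h <> 0 -> Rabs h < delta -> I (s + h) -> evo (s + h) s x y ->
    nrm ((/ h) [*] (y [-] x) [-] A s x) < eps.
Proof.
  intros Is Dx Heps.
  destruct (interval_nbhd s Is) as (p & q & d & Ip & Iq & Hpq & Hd & Hnb).
  destruct (Hloc p q Ip Iq ltac:(lra)) as [L [HL Hlip]].
  set (v := A s x). set (a := nrm v). set (n0 := nrm x).
  assert (Pa : 0 <= a) by apply nrm_ge0. assert (P0 : 0 <= n0) by apply nrm_ge0.
  (* The terms governed by [eta] will sum to at most 2 eta (2a + 1) <= eps^2/2, by eta^2 <= eta; the
     term with [K] adds at most eps^2/4. *)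
  set (eta := Rmin 1 (eps * eps / (4 * (2 * a + 1)))).
  assert (Heta : 0 < eta <= 1 /\ eta * (2 * a + 1) <= eps * eps / 4).
  { assert (Q : 0 < eps * eps / (4 * (2 * a + 1))) by (apply Rdiv_lt_0_compat; nra).
    split; [split; [apply Rmin_pos; lra | apply Rmin_l] |].
    apply Rle_trans with (eps * eps / (4 * (2 * a + 1)) * (2 * a + 1)).
    - apply Rmult_le_compat_r; [lra | apply Rmin_r].
    - right. field. lra. }
  clearbody eta. destruct Heta as [[He0 He1] He2].
  (* The weak estimate is tested only with vectors of [D], so [v] is approximated by one. *)
  destruct (Hdense v (eta / 2)) as [psi [Dpsi Hpsi]]; [lra |].
  set (K := L * (nrm (A s psi) + nrm psi) * n0 + nrm (A s psi) * (a + 1)).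
  assert (Hexp : exists d1, d1 > 0 /\ forall h, Rabs h < d1 ->
            exp (L * Rabs h) * (a + n0) - n0 <= a + eta).
  { destruct (derivable_continuous_pt _ _ (derivable_pt_exp 0) (eta / (a + n0 + 1)))
      as [d1 [Hd1 Hc]]; [apply Rdiv_lt_0_compat; lra |].
    exists (d1 / (L + 1)). split; [apply Rdiv_lt_0_compat; lra |]. intros h Hh.
    assert (Ph := Rabs_pos h).
    assert (HLh : Rabs (L * Rabs h - 0) < d1).
    { rewrite Rminus_0_r, Rabs_right by (apply Rle_ge, Rmult_le_pos; assumption).
      apply (Rmult_lt_compat_l (L + 1)) in Hh; [| lra].
      replace ((L + 1) * (d1 / (L + 1))) with d1 in Hh by (field; lra). lra. }
    (* Continuity of exp at 0 is phrased for points other than 0, so the value 0 is treated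
       apart. *)
    destruct (Req_dec (L * Rabs h) 0) as [-> | Hne]; [rewrite exp_0; lra |].
    specialize (Hc (L * Rabs h)). simpl in Hc. unfold Rdist, D_x, no_cond in Hc.
    specialize (Hc (conj (conj Logic.I (not_eq_sym Hne)) HLh)).
    rewrite exp_0 in Hc. apply Rabs_def2 in Hc.
    assert (Q : (exp (L * Rabs h) - 1) * (a + n0) <= eta / (a + n0 + 1) * (a + n0))
      by (apply Rmult_le_compat_r; lra).
    assert (Q2 : eta / (a + n0 + 1) * (a + n0) <= eta).
    { apply Rle_trans with (eta / (a + n0 + 1) * (a + n0 + 1)); [| right; field; lra].
      apply Rmult_le_compat_l; [apply Rlt_le, Rdiv_lt_0_compat |]; lra. }
    lra. }
  destruct Hexp as [d1 [Hd1 Hexp]].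
  set (d2 := eps * eps / (8 * (Rabs K + 1))).
  assert (PK := Rabs_pos K).
  assert (Hd2 : d2 > 0) by (apply Rdiv_lt_0_compat; nra).
  exists (Rmin d (Rmin d1 d2)). split; [repeat apply Rmin_pos; lra |].
  intros h y Hh Hhd Ih Hy.
  assert (G := Rlt_le_trans _ _ _ Hhd (Rmin_l _ _)).
  assert (G' := Rlt_le_trans _ _ _ Hhd (Rmin_r _ _)).
  assert (G1 := Rlt_le_trans _ _ _ G' (Rmin_l _ _)).
  assert (G2 := Rlt_le_trans _ _ _ G' (Rmin_r _ _)). clear G'.
  assert (Et : s + h - s = h) by ring.
  assert (Hsh : p <= s + h <= q) by (apply Hnb; [exact Ih | rewrite Et; exact G]).
  destruct (evo_exists_local p q s (s + h) x L Ip Iq Hpq Hsh Dx HL Hlip) as (y' & Hy' & B1 & B2).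
  rewrite (evo_unique _ _ _ _ _ Ih Is Hy' Hy), Et in *. clear y' Hy'.
  fold v a n0 in B1, B2. specialize (B2 psi Dpsi). specialize (Hexp h G1).
  set (C := exp (L * Rabs h) * (a + n0) - n0) in *.
  assert (Ph : 0 < Rabs h) by (apply Rabs_pos_lt, Hh).
  assert (Ehh : h * h = Rabs h * Rabs h) by apply sq_Rabs.
  assert (PA := nrm_ge0 (A s psi)).
  assert (HK : L * (nrm (A s psi) + nrm psi) * n0 + nrm (A s psi) * C <= Rabs K).
  { eapply Rle_trans; [| apply Rle_abs]. unfold K.
    apply Rplus_le_compat_l, Rmult_le_compat_l; lra. }
  set (dq := (/ h) [*] (y [-] x)).
  assert (N1 : nrm dq <= C).
  { unfold dq. rewrite nrm_rscal, Rabs_inv.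
    apply (Rmult_le_reg_l (Rabs h)); [exact Ph |].
    rewrite <- Rmult_assoc, Rinv_r, Rmult_1_l by lra. lra. }
  assert (PC : 0 <= C) by (eapply Rle_trans; [apply nrm_ge0 | exact N1]).
  assert (N2 : Rabs (rip psi dq - rip psi v) <= Rabs K * Rabs h).
  { unfold dq. rewrite rip_rscal_r.
    replace (/ h * rip psi (y [-] x) - rip psi v)
      with (/ h * (rip psi (y [-] x) - h * rip psi v)) by (field; exact Hh).
    rewrite Rabs_mult, Rabs_inv.
    apply (Rmult_le_reg_l (Rabs h)); [exact Ph |].
    rewrite <- Rmult_assoc, Rinv_r, Rmult_1_l by lra.
    eapply Rle_trans; [exact B2 |]. rewrite Ehh.
    replace (Rabs h * (Rabs K * Rabs h)) with (Rabs K * (Rabs h * Rabs h)) by ring.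
    apply Rmult_le_compat_r; [apply Rmult_le_pos; lra | exact HK]. }
  apply nrm_lt; [lra |].
  (* In the cross term [v] is split as psi + (v - psi): the pairing with [psi] converges by [N2],
     and the rest is small. *)
  assert (E : rip (dq [-] v) (dq [-] v)
              = rip dq dq - rip v v - 2 * (rip psi dq - rip psi v)
                - 2 * rip (v [-] psi) dq + 2 * rip (v [-] psi) v).
  { generalize dq. intro w. rips. rewrite (rip_sym w v). ring. }
  rewrite E, <- !nrm_sq. fold a.
  assert (F1 := cauchy_schwarz (v [-] psi) dq). assert (F2 := cauchy_schwarz (v [-] psi) v).
  fold a in F2. assert (Pv := nrm_ge0 (v [-] psi)). assert (Pd := nrm_ge0 dq).
  apply Rabs_le_inv in F1. apply Rabs_le_inv in F2. apply Rabs_le_inv in N2.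
  assert (F3 : nrm (v [-] psi) * nrm dq <= eta / 2 * (a + 1)) by (apply Rmult_le_compat; lra).
  assert (F4 : nrm (v [-] psi) * a <= eta / 2 * a) by (apply Rmult_le_compat_r; lra).
  assert (F5 : nrm dq * nrm dq <= (a + eta) * (a + eta)) by (apply Rmult_le_compat; lra).
  assert (F6 : eta * eta <= eta) by nra.
  assert (F7 : Rabs K * Rabs h <= eps * eps / 8).
  { apply Rle_trans with ((Rabs K + 1) * d2); [apply Rmult_le_compat; lra |].
    right. unfold d2. field. lra. }
  assert (F8 : 0 < eps * eps) by nra.
  lra.
Qed.

(** Once the difference quotient is within 1 of A(s) x, |y - x| is at most (|A(s) x| + 1) |t -
    s|. *)
Lemma evo_continuous s x eps : I s -> D x -> eps > 0 -> exists delta, delta > 0 /\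
  forall t y, I t -> Rabs (t - s) < delta -> evo t s x y -> nrm (y [-] x) < eps.
Proof.
  intros Is Dx Heps. destruct (evo_deriv s x 1 Is Dx Rlt_0_1) as [d [Hd H]].
  set (a := nrm (A s x)). assert (Pa : 0 <= a) by apply nrm_ge0.
  exists (Rmin d (eps / (a + 1))). split.
  { apply Rmin_pos; [exact Hd | apply Rdiv_lt_0_compat; lra]. }
  intros t y It Ht Hy. destruct (Req_dec t s) as [-> | Hne].
  { rewrite (evo_unique _ _ _ _ _ Is Is Hy (evo_id _ _ Is Dx)).
    replace (x [-] x) with 0v by vec. rewrite nrm_0. exact Heps. }
  assert (G1 := Rlt_le_trans _ _ _ Ht (Rmin_l _ _)).
  assert (G2 := Rlt_le_trans _ _ _ Ht (Rmin_r _ _)).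
  specialize (H (t - s) y ltac:(lra) G1). replace (s + (t - s)) with t in H by ring.
  specialize (H It Hy).
  assert (B := nrm_le_sub ((/ (t - s)) [*] (y [-] x)) (A s x)). fold a in B.
  rewrite nrm_rscal, Rabs_inv in B.
  assert (Ph : 0 < Rabs (t - s)) by (apply Rabs_pos_lt; lra).
  assert (B2 : / Rabs (t - s) * nrm (y [-] x) < a + 1) by lra.
  apply (Rmult_lt_compat_l (Rabs (t - s))) in B2; [| exact Ph].
  rewrite <- Rmult_assoc, Rinv_r, Rmult_1_l in B2 by lra.
  apply (Rmult_lt_compat_r (a + 1)) in G2; [| lra].
  replace (eps / (a + 1) * (a + 1)) with eps in G2 by (field; lra). lra.
Qed.

(* The value at x of the isometric extension of evo t s from D to the whole space. *)
Definition is_extension (t s : R) (x y : V) : Prop :=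
  forall x0 y0, evo t s x0 y0 -> nrm (y [-] y0) <= nrm (x [-] x0).

(** * The propagator on the whole space *)

Definition propagator (t s : R) (x : V) : V := epsilon (inhabits 0v) (is_extension t s x).

Local Notation U := propagator.

(** [x] is approximated from [D]; the evolution is linear and isometric there, so the images are
    Cauchy, and their limit is an extension value. *)
Lemma propagator_spec t s x : I t -> I s -> is_extension t s x (U t s x).
Proof.
  intros It Is. unfold U. apply epsilon_spec.
  assert (Hn : forall n : nat, exists z : V * V,
            evo t s (fst z) (snd z) /\ nrm (x [-] fst z) < / (INR n + 1)).
  { intro n. destruct (Hdense x (/ (INR n + 1))) as [x0 [Dx0 Hx0]].
    { apply Rinv_0_lt_compat. assert (P := pos_INR n). lra. }
    destruct (evo_exists t s x0 It Is Dx0) as [y0 Hy0]. exists (x0, y0). auto. }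
  pose (z := fun n => proj1_sig (constructive_indefinite_description _ (Hn n))).
  assert (Hz : forall n, evo t s (fst (z n)) (snd (z n)) /\ nrm (x [-] fst (z n)) < / (INR n + 1)).
  { intro n. exact (proj2_sig (constructive_indefinite_description _ (Hn n))). }
  clearbody z.
  assert (Hlim : cv0 (fun n => nrm (x [-] fst (z n)))).
  { intros eps Heps. destruct (cv0_inv_nat eps Heps) as [N HN]. exists N. intros n Hn'.
    specialize (HN n Hn'). apply Rabs_def2 in HN.
    rewrite Rabs_right by apply Rle_ge, nrm_ge0. destruct (Hz n). lra. }
  destruct (cauchy_vlim (fun n => snd (z n))) as [y Hy].
  { intros eps Heps. destruct (Hlim (eps / 2)) as [N HN]; [lra |].
    exists N. intros i j Hi Hj. specialize (HN i Hi) as Bi. specialize (HN j Hj) as Bj.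
    rewrite Rabs_right in Bi, Bj by apply Rle_ge, nrm_ge0.
    rewrite (evo_nrm t s _ _ It Is (evo_sub _ _ _ _ _ _ It Is (proj1 (Hz i)) (proj1 (Hz j)))).
    assert (T := nrm_sub_triangle (fst (z i)) x (fst (z j))).
    rewrite (nrm_sub_sym (fst (z i)) x) in T. lra. }
  exists y. intros x0 y0 H0.
  apply (cv0_le _ _ (fun n => nrm (snd (z n) [-] y) + nrm (x [-] fst (z n))));
    [| apply cv0_plus; assumption].
  intro n.
  assert (E := evo_nrm t s _ _ It Is (evo_sub _ _ _ _ _ _ It Is (proj1 (Hz n)) H0)).
  assert (T1 := nrm_sub_triangle y (snd (z n)) y0).
  assert (T2 := nrm_sub_triangle (fst (z n)) x x0).
  rewrite (nrm_sub_sym (fst (z n)) x) in T2. rewrite (nrm_sub_sym y (snd (z n))) in T1. lra.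
Qed.

Lemma propagator_evo t s x y : I t -> I s -> evo t s x y -> U t s x = y.
Proof.
  intros It Is H. apply nrm_sub_eq.
  assert (B := propagator_spec t s x It Is x y H).
  replace (x [-] x) with 0v in B by vec. rewrite nrm_0 in B. exact B.
Qed.

Lemma evo_propagator t s x : I t -> I s -> D x -> evo t s x (U t s x).
Proof.
  intros It Is Dx. destruct (evo_exists t s x It Is Dx) as [y Hy].
  rewrite (propagator_evo t s x y It Is Hy). exact Hy.
Qed.

Lemma propagator_near t s x x0 : I t -> I s -> D x0 ->
  nrm (U t s x [-] U t s x0) <= nrm (x [-] x0).
Proof. intros It Is Dx0. apply propagator_spec; auto. apply evo_propagator; assumption. Qed.

Lemma propagator_contr t s x y : I t -> I s -> nrm (U t s x [-] U t s y) <= nrm (x [-] y).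
Proof.
  intros It Is. apply Rle_plus_epsilon. intros eps Heps.
  destruct (Hdense y (eps / 2)) as [y0 [Dy0 Hy0]]; [lra |].
  assert (B1 := propagator_near t s x y0 It Is Dy0).
  assert (B2 := propagator_near t s y y0 It Is Dy0).
  assert (T1 := nrm_sub_triangle (U t s x) (U t s y0) (U t s y)).
  assert (T2 := nrm_sub_triangle x y y0).
  rewrite (nrm_sub_sym (U t s y0)) in T1. lra.
Qed.

Lemma propagator_lin t s c x y : I t -> I s ->
  U t s (vscal HS c x [+] y) = vscal HS c (U t s x) [+] U t s y.
Proof.
  intros It Is. apply nrm_sub_eq. apply Rle_plus_epsilon. intros eps Heps. rewrite Rplus_0_l.
  set (k := Rabs (Cre c) + Rabs (Cim c)).
  assert (Pk : 0 <= k)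
    by (assert (P1 := Rabs_pos (Cre c)); assert (P2 := Rabs_pos (Cim c)); unfold k; lra).
  (* The error k eta + eta of the combination is counted twice, once for the arguments and once for
     the values, for a total of eps. *)
  set (eta := eps / (2 * (k + 1))).
  assert (Heta : eta > 0) by (apply Rdiv_lt_0_compat; lra).
  destruct (Hdense x eta Heta) as [x0 [Dx0 Hx0]].
  destruct (Hdense y eta Heta) as [y0 [Dy0 Hy0]].
  assert (E : U t s (vscal HS c x0 [+] y0) = vscal HS c (U t s x0) [+] U t s y0).
  { apply propagator_evo; try assumption. apply evo_lin; auto using evo_propagator. }
  assert (B : forall v w v0 w0,
    nrm ((vscal HS c v [+] w) [-] (vscal HS c v0 [+] w0)) <= k * nrm (v [-] v0) + nrm (w [-] w0)).
  { intros v w v0 w0.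
    replace ((vscal HS c v [+] w) [-] (vscal HS c v0 [+] w0))
      with (vscal HS c (v [-] v0) [+] (w [-] w0)).
    - eapply Rle_trans; [apply nrm_triangle |].
      assert (Q := nrm_vscal_le c (v [-] v0)). fold k in Q. lra.
    - replace (v [-] v0) with (vscal HS (RtoC (-1)) v0 [+] v) by (symmetry; apply vsub_eq_lin).
      rewrite vscal_distr_v, vscal_assoc.
      replace (Cmul c (RtoC (-1))) with (Cmul (RtoC (-1)) c) by (apply Ceq; simpl; ring).
      rewrite <- vscal_assoc. fold (rscal (-1) (vscal HS c v0)). vec. }
  assert (B1 := propagator_contr t s (vscal HS c x [+] y) (vscal HS c x0 [+] y0) It Is).
  assert (B2 := B x y x0 y0).
  assert (B3 := B (U t s x) (U t s y) (U t s x0) (U t s y0)).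
  assert (B4 := propagator_near t s x x0 It Is Dx0).
  assert (B5 := propagator_near t s y y0 It Is Dy0).
  rewrite E in B1.
  assert (T := nrm_sub_triangle (U t s (vscal HS c x [+] y))
                 (vscal HS c (U t s x0) [+] U t s y0) (vscal HS c (U t s x) [+] U t s y)).
  rewrite (nrm_sub_sym (vscal HS c (U t s x0) [+] U t s y0)) in T.
  assert (B6 := Rmult_le_compat_l _ _ _ Pk B4).
  assert (B7 := Rmult_le_compat_l _ _ _ Pk (Rlt_le _ _ Hx0)).
  assert (Eeta : 2 * (k * eta + eta) = eps) by (unfold eta; field; lra).
  lra.
Qed.

Lemma propagator_comp r s t x : I r -> I s -> I t -> U r s (U s t x) = U r t x.
Proof.
  intros Ir Is It. apply nrm_sub_eq. apply Rle_plus_epsilon. intros eps Heps. rewrite Rplus_0_l.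
  destruct (Hdense x (eps / 2)) as [x0 [Dx0 Hx0]]; [lra |].
  assert (H0 := evo_propagator s t x0 Is It Dx0).
  assert (E : U r s (U s t x0) = U r t x0).
  { symmetry. apply propagator_evo; try assumption.
    apply (evo_comp r s t x0 (U s t x0)); try assumption.
    apply evo_propagator; try assumption. apply (evo_D _ _ _ _ H0). }
  assert (B1 := propagator_contr r s (U s t x) (U s t x0) Ir Is).
  assert (B2 := propagator_contr s t x x0 Is It).
  assert (B3 := propagator_contr r t x0 x Ir It). rewrite (nrm_sub_sym x0) in B3.
  assert (T := nrm_sub_triangle (U r s (U s t x)) (U r s (U s t x0)) (U r t x)).
  rewrite E in *. lra.
Qed.

Lemma propagator_id t x : I t -> U t t x = x.
Proof.
  intros It. apply nrm_sub_eq. apply Rle_plus_epsilon. intros eps Heps. rewrite Rplus_0_l.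
  destruct (Hdense x (eps / 2)) as [x0 [Dx0 Hx0]]; [lra |].
  assert (B := propagator_spec t t x It It x0 x0 (evo_id _ _ It Dx0)).
  assert (T := nrm_sub_triangle (U t t x) x0 x). rewrite (nrm_sub_sym x0) in T. lra.
Qed.

(** U(t, s) and its inverse U(s, t) are both contractions. *)
Lemma propagator_nrm t s x : I t -> I s -> nrm (U t s x) = nrm x.
Proof.
  intros It Is.
  assert (Z : forall t s x, I t -> I s -> nrm (U t s x) <= nrm x).
  { clear t s x It Is. intros t s x It Is.
    assert (Z0 : U t s 0v = 0v).
    { apply propagator_evo; try assumption.
      destruct (evo_exists t s 0v It Is D_0) as [y Hy].
      replace y with 0v in Hy; [exact Hy |].
      symmetry. apply nrm_eq0. rewrite (evo_nrm _ _ _ _ It Is Hy), nrm_0. lra. }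
    assert (B := propagator_contr t s x 0v It Is). rewrite Z0 in B.
    replace (U t s x [-] 0v) with (U t s x) in B by vec.
    replace (x [-] 0v) with x in B by vec. exact B. }
  apply Rle_antisym; [apply Z; assumption |].
  rewrite <- (propagator_id s x Is) at 1. rewrite <- (propagator_comp s t s x) by assumption.
  apply Z; assumption.
Qed.

(** Polarisation preserves the real product; complex linearity applied to i y then gives the
    imaginary part. *)
Lemma propagator_inner t s x y : I t -> I s ->
  inner HS (U t s x) (U t s y) = inner HS x y.
Proof.
  intros It Is.
  assert (P : forall x y, rip (U t s x) (U t s y) = rip x y).
  { clear x y. intros x y.
    assert (Q : forall x, rip (U t s x) (U t s x) = rip x x)
      by (intro z; rewrite <- !nrm_sq, propagator_nrm by assumption; reflexivity).
    assert (E := Q (x [+] y)).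
    rewrite <- (vscal_1 _ HS x) in E at 1 2. rewrite propagator_lin, !vscal_1 in E by assumption.
    revert E. rips. rewrite !Q, (rip_sym (U t s y) (U t s x)), (rip_sym y x). lra. }
  apply inner_eq; [apply P |]. rewrite <- (P x). f_equal.
  rewrite (vscal_eq_add Ci y), propagator_lin by assumption.
  rewrite (nrm_eq0 (U t s 0v)) by (rewrite propagator_nrm, nrm_0 by assumption; lra).
  apply vscal_eq_add.
Qed.

Lemma propagator_continuous_fst s x eps : I s -> eps > 0 -> exists delta, delta > 0 /\
  forall t, I t -> Rabs (t - s) < delta -> nrm (U t s x [-] x) < eps.
Proof.
  intros Is Heps. destruct (Hdense x (eps / 4)) as [x0 [Dx0 Hx0]]; [lra |].
  destruct (evo_continuous s x0 (eps / 2) Is Dx0) as [d [Hd H]]; [lra |].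
  exists d. split; [exact Hd |]. intros t It Ht.
  specialize (H t _ It Ht (evo_propagator t s x0 It Is Dx0)).
  assert (B := propagator_near t s x x0 It Is Dx0).
  assert (T1 := nrm_sub_triangle (U t s x) (U t s x0) x).
  assert (T2 := nrm_sub_triangle (U t s x0) x0 x). rewrite (nrm_sub_sym x0) in T2. lra.
Qed.

Lemma propagator_unitary : unitary_propagator HS I U.
Proof.
  split; [| split; [| split]].
  - intros t s It Is. split; [| split].
    + intros. apply propagator_lin; assumption.
    + intros. apply propagator_inner; assumption.
    + intro y. exists (U s t y). rewrite propagator_comp by assumption.
      apply propagator_id, It.
  - intros. apply propagator_comp; assumption.
  - intros. apply propagator_id; assumption.
  (* Joint continuity reduces to continuity at the initial time: U(t',s')x - U(t,s)x is U(t',s')(x -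
     U(s',s)x) plus (U(t',t) - 1)U(t,s)x, and U(t',s') does not enlarge norms. *)
  - intros x t s It Is eps Heps.
    destruct (propagator_continuous_fst t (U t s x) (eps / 2) It) as [d [Hd H]]; [lra |].
    destruct (propagator_continuous_fst s x (eps / 2) Is) as [d' [Hd' H']]; [lra |].
    exists (Rmin d d'). split; [apply Rmin_pos; lra |]. intros t' s' It' Is' Ht' Hs'.
    assert (G := Rlt_le_trans _ _ _ Ht' (Rmin_l _ _)).
    assert (G' := Rlt_le_trans _ _ _ Hs' (Rmin_r _ _)).
    specialize (H t' It' G). specialize (H' s' Is' G').
    rewrite propagator_comp in H by assumption.
    assert (B := propagator_contr t' s' x (U s' s x) It' Is').
    rewrite propagator_comp, (nrm_sub_sym x) in B by assumption.
    assert (T := nrm_sub_triangle (U t' s' x) (U t' s x) (U t s x)). lra.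
Qed.

(** The factorisation U(t+h,s) = U(t+h,t) U(t,s) makes [t] the initial time of the differentiated
    evolution. *)
Lemma propagator_deriv t s x : I t -> I s -> D x ->
  D (U t s x) /\ vderiv_within HS I (fun r => U r s x) t (A t (U t s x)).
Proof.
  intros It Is Dx.
  assert (Dy : D (U t s x)) by apply (evo_D _ _ _ _ (evo_propagator t s x It Is Dx)).
  split; [exact Dy |]. intros eps Heps.
  destruct (evo_deriv t (U t s x) eps It Dy Heps) as [d [Hd H]].
  exists d. split; [exact Hd |]. intros h Hh Hhd Ih.
  apply H; try assumption. rewrite <- (propagator_comp (t + h) t s) by assumption.
  apply evo_propagator; assumption.
Qed.

End Propagator.

(** * From the Hamiltonians to the skew-adjoint family *)

(** For maximality, the real identity is used at [psi] and at i psi. Together they give the complex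
    identity <phi, H psi> = <i eta, psi>, to which self-adjointness applies. *)
Lemma self_adjoint_skew (H : V -> V) : self_adjoint_on HS D H ->
  skew_adjoint (fun x => vscal HS (Copp Ci) (H x)).
Proof.
  intros [[Hlin Hsym] Hmax].
  assert (Er : forall x y, rip x (vscal HS (Copp Ci) y) = Cim (inner HS x y)).
  { intros x y. unfold rip. rewrite inner_scal_r. simpl. ring. }
  assert (El : forall x y, rip (vscal HS (Copp Ci) x) y = - Cim (inner HS x y)).
  { intros x y. rewrite rip_sym, Er, inner_conj. simpl. ring. }
  split; [| split].
  - intros c x y Dx Dy. rewrite Hlin by assumption.
    rewrite vscal_distr_v, !vscal_assoc. f_equal. f_equal. apply Ceq; simpl; ring.
  - intros x y Dx Dy. rewrite Er, El, Hsym by assumption. ring.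
  - intros phi eta He.
    assert (E : forall psi, D psi -> inner HS phi (H psi) = inner HS (vscal HS Ci eta) psi).
    { intros psi Dpsi.
      assert (E1 := He psi Dpsi). rewrite Er in E1.
      assert (E2 := He _ (D_vscal Ci psi Dpsi)).
      assert (EH : H (vscal HS Ci psi) = vscal HS Ci (H psi)).
      { assert (H0 : H 0v = 0v).
        { assert (Q := Hlin (RtoC (-1)) 0v 0v D_0 D_0).
          fold (rscal (-1) 0v) (rscal (-1) (H 0v)) in Q.
          replace ((-1) [*] 0v [+] 0v) with 0v in Q by vec. rewrite Q. vec. }
        rewrite vscal_eq_add, Hlin, H0 by (assumption || apply D_0). vec. }
      rewrite EH, vscal_assoc in E2.
      replace (Cmul (Copp Ci) Ci) with C1 in E2 by (apply Ceq; simpl; ring).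
      rewrite vscal_1, rip_Ci_r in E2.
      rewrite (inner_conj _ HS (vscal HS Ci eta)), inner_scal_r, (inner_conj _ HS psi eta).
      unfold rip in *. apply Ceq; simpl; lra. }
    destruct (Hmax phi _ E) as [Dphi Eta]. split; [exact Dphi |].
    rewrite <- Eta, vscal_assoc.
    replace (Cmul (Copp Ci) Ci) with C1 by (apply Ceq; simpl; ring).
    symmetry. apply vscal_1.
Qed.

Lemma nrm_vscal_opp_Ci x : nrm (vscal HS (Copp Ci) x) = nrm x.
Proof.
  unfold vnorm. f_equal. rewrite inner_scal_r, inner_conj, inner_scal_r. simpl. ring.
Qed.

Lemma vscal_vsub c x y : vscal HS c x [-] vscal HS c y = vscal HS c (x [-] y).
Proof.
  rewrite !vsub_eq_lin, vscal_distr_v. unfold rscal. rewrite !vscal_assoc. f_equal. f_equal.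
  apply Ceq; simpl; ring.
Qed.

(** [G] is abstract so that in the induction on [n] it can stand for the graph norm of the full sum,
    which does not shrink with [n]. *)
Lemma vsum_lipschitz (n : nat) (f : nat -> R -> R) (Hop : nat -> V -> V) (P : R -> Prop)
  (G : R -> V -> R) :
  (forall i, (i < n)%nat -> exists M, 0 <= M /\ forall t s x, P t -> P s -> D x ->
     Rabs (f i t - f i s) * nrm (Hop i x) <= M * Rabs (t - s) * G s x) ->
  exists M, 0 <= M /\ forall t s x, P t -> P s -> D x ->
    nrm (vsum HS n (fun i => vscal HS (RtoC (f i t)) (Hop i x))
         [-] vsum HS n (fun i => vscal HS (RtoC (f i s)) (Hop i x)))
    <= M * Rabs (t - s) * G s x.
Proof.
  induction n as [| n IH]; intro H.
  { exists 0. split; [lra |]. intros t s x _ _ _. simpl.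
    replace (0v [-] 0v) with 0v by vec. rewrite nrm_0. lra. }
  destruct IH as [M [HM IH]]; [intros; apply H; lia |].
  destruct (H n ltac:(lia)) as [M' [HM' H']].
  exists (M + M'). split; [lra |]. intros t s x Pt Ps Dx. simpl.
  specialize (IH t s x Pt Ps Dx). specialize (H' t s x Pt Ps Dx).
  rewrite vadd_vsub_vsub. eapply Rle_trans; [apply nrm_triangle |].
  fold (rscal (f n t) (Hop n x)) (rscal (f n s) (Hop n x)).
  replace (f n t [*] Hop n x [-] f n s [*] Hop n x)
    with ((f n t - f n s) [*] Hop n x) by vec.
  rewrite nrm_rscal. lra.
Qed.

End RealStructure.

Theorem theorem1
  (V : Type) (HS : HilbertSpace V)
  (D : V -> Prop) (n : nat) (Hop : nat -> V -> V) (I : R -> Prop) (f : nat -> R -> R)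
  (HD_sub : subspace HS D) (HD_dense : dense HS D)
  (HHi : forall i, (i < n)%nat -> symmetric_on HS D (Hop i))
  (HI : interval I)
  (Hsa : forall t, I t ->
     self_adjoint_on HS D (fun x => vsum HS n (fun i => vscal HS (RtoC (f i t)) (Hop i x))))
  (Hf : forall i, (i < n)%nat -> C1_on I (f i))
  (Hbound : forall i, (i < n)%nat -> exists K, K > 0 /\
     forall (Psi : V) (t : R), D Psi -> I t ->
       vnorm HS (Hop i Psi)
       <= K * (vnorm HS (vsum HS n (fun j => vscal HS (RtoC (f j t)) (Hop j Psi)))
               + vnorm HS Psi)) :
  exists U : R -> R -> V -> V,
    unitary_propagator HS I U /\
    forall s Psi_s, I s -> D Psi_s ->
      U s s Psi_s = Psi_s /\
      forall t, I t ->
        D (U t s Psi_s) /\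
        vderiv_within HS I (fun r => U r s Psi_s) t
          (vscal HS (Copp Ci)
             (vsum HS n (fun i => vscal HS (RtoC (f i t)) (Hop i (U t s Psi_s))))).
Proof.
  set (H := fun t x => vsum HS n (fun i => vscal HS (RtoC (f i t)) (Hop i x))).
  set (A := fun t x => vscal HS (Copp Ci) (H t x)).
  assert (HA : forall t, I t -> skew_adjoint HS D (A t)).
  { intros t It. apply self_adjoint_skew; [exact HD_sub | apply Hsa, It]. }
  (* Each summand is bounded by |f_i(t) - f_i(s)| |H_i x| <= M |t - s| K (|H(s) x| + |x|), with [M]
     from the compact interval and [K] from (iii); the factor -i leaves norms unchanged. *)
  assert (Hloc : forall p q, I p -> I q -> p <= q -> exists L, 0 <= L /\
     forall t s x, p <= t <= q -> p <= s <= q -> D x ->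
       vnorm HS (vsub HS (A t x) (A s x))
       <= L * Rabs (t - s) * (vnorm HS (A s x) + vnorm HS x)).
  { intros p q Ip Iq Hpq.
    destruct (vsum_lipschitz HS D n f Hop (fun t => p <= t <= q)
                (fun s x => vnorm HS (H s x) + vnorm HS x)) as [L [HL B]].
    - intros i Hi.
      destruct (C1_lipschitz I (f i) p q HI (Hf i Hi) Ip Iq Hpq) as [M [HM BM]].
      destruct (Hbound i Hi) as [K [HK BK]].
      exists (M * K). split; [apply Rmult_le_pos; lra |]. intros t s x Ht Hs Dx.
      replace (M * K * Rabs (t - s) * (vnorm HS (H s x) + vnorm HS x))
        with ((M * Rabs (t - s)) * (K * (vnorm HS (H s x) + vnorm HS x))) by ring.
      apply Rmult_le_compat; [apply Rabs_pos | apply nrm_ge0 | apply BM; assumption |].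
      apply BK; [exact Dx | apply (HI p s q); tauto].
    - exists L. split; [exact HL |]. intros t s x Ht Hs Dx. unfold A.
      rewrite vscal_vsub, !nrm_vscal_opp_Ci. apply B; assumption. }
  exists (propagator HS D A). split.
  - apply propagator_unitary; assumption.
  - intros s Psi_s Is DPsi. split.
    + apply (propagator_id HS D HD_sub A I); assumption.
    + intros t It. apply (propagator_deriv HS D HD_sub A I); assumption.
Qed.
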